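(* Let $n\ge1$ be fixed, $\beta\in[0,1]$, and, for each dimension $d$, let $X_1,\ldots,X_n$ be a random sample (i.i.d.) from $N(0,\Sigma_d)$, where $\Sigma_d$ has eigenvalues $\lambda_1\ge\cdots\ge\lambda_d$ with orthonormal eigenvectors $u_1,\ldots,u_d$. Suppose that $u_1=(u_{1,1},\ldots,u_{d,1})^T$ with $u_{i,1}\neq0$ for $i=1,\ldots,\lfloor d^\beta\rfloor$ and $u_{i,1}=0$ otherwise. Suppose that: (a) $\lambda_1\sim d^\alpha$, $\lambda_2\sim d^\theta$ and $\sum_{i=2}^d\lambda_i\sim d$, where $\theta\in[0,\alpha)$ and $\alpha\in(0,1]$; (b) for a non-negative constant $C$, $\limsup_{d\to\infty}\frac{\lambda_1}{\sum_{i=2}^d\lambda_i}=C$, and $\frac{\sum_{i=1}^d\lambda_i^2}{(\sum_{i=1}^d\lambda_i)^2}\to0$ as $d\to\infty$; (c) $\max_{1\le i\le\lfloor d^\beta\rfloor}|u_{i,1}|^{-1}\sim d^{\eta/2}$, where $\eta\in[0,\alpha)$; (d) the vectors $H_j=\sum_{i=2}^d(X_j^Tu_i)u_i$, $j=1,\ldots,n$, which are i.i.d. $N(0,\Delta_d)$ with $\Delta_d=(m_{kl})_{d\times d}$, satisfy the mixing condition $$|m_{kl}|\le m_{kk}^{1/2}m_{ll}^{1/2}\rho_{|k-l|},\qquad 1\le k\ne l\le\lfloor d^\beta\rfloor,$$ where $\rho_t<1$ for all $t>1$ and $\rho_t\log t\to0$ as $t\to\infty$; (e) the thresholding parameter $\lambda=\lambda(d)$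 satisfies $(\log d)^\delta\,d^{\theta/2}\le\lambda\le d^{\gamma/2}$ for all sufficiently large $d$, where $\delta\in(\frac12,\infty)$ and $\gamma\in(\theta,\alpha-\eta)$. Let $h_\lambda$ be the soft thresholding, hard thresholding or SCAD thresholding function. Then the first-step sparse loading vector $\hat u_1=h_\lambda(X_{(d)}\tilde v_1)/\|h_\lambda(X_{(d)}\tilde v_1)\|$ of the RSPCA algorithm is consistent with $u_1$, i.e. $\arccos(|\langle\hat u_1,u_1\rangle|)\to0$ in probability as $d\to\infty$.
   Context: All quantities are indexed by $d$; $n$ is fixed and $d\to\infty$. The symbols $\lambda_i$ with an index are eigenvalues of $\Sigma_d$; $\lambda$ without an index is the thresholding parameter. The sequence $(\rho_t)_{t\ge1}$ does not depend on $d$. Notation: $a_d\sim b_d$ means there are constants $0<c_1\le c_2<\infty$ with $c_1\le\liminf_{d\to\infty} a_d/b_d\le\limsup_{d\to\infty} a_d/b_d\le c_2$. First step of RSPCA (regularized sparse PCA): $X_{(d)}=[X_1,\ldots,X_n]$ is the $d\times n$ data matrix, $\tilde v_1\in\mathbb R^n$ is the unit vector in the best rank-one approximation (in Frobenius norm) $\tilde u_1\tilde v_1^T$ of $X_{(d)}$ given by the SVD, i.e. a unit eigenvector of $X_{(d)}^TX_{(d)}$ for its largest eigenvalue. The thresholding function $h_\lambda$ is applied componentwise; if $h_\lambda(X_{(d)}\tilde v_1)=0$, $\hat u_1$ is taken to be the zero vector. The thresholding functions are: hard, $h_\lambda(y)=y\,1_{\{|y|>\lambda\}}$; soft, $h_\lambda(y)={\rm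 sign}(y)(|y|-\lambda)_+$; SCAD (with a fixed constant $a>2$), $h_\lambda(y)={\rm sign}(y)(|y|-\lambda)_+$ if $|y|\le2\lambda$, $h_\lambda(y)=\frac{(a-1)y-{\rm sign}(y)a\lambda}{a-2}$ if $2\lambda<|y|\le a\lambda$, and $h_\lambda(y)=y$ if $|y|>a\lambda$. *)

(* Defs.v *)
From HB Require Import structures.
From mathcomp Require Import all_boot all_order all_algebra.
From mathcomp Require Import all_classical all_reals all_analysis.

Set Implicit Arguments.
Unset Strict Implicit.
Unset Printing Implicit Defensive.

Import Order.TTheory GRing.Theory Num.Theory.
Import numFieldNormedType.Exports.

Local Open Scope classical_set_scope.
Local Open Scope ring_scope.

(* The sigma-algebra generated by the coordinate maps; on 'cV[R]_d it is the
   Borel sigma-algebra of R^d. *)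
Definition measure_matrix_display : measure_display -> measure_display.
Proof. exact. Qed.

Section measurable_matrix.
Context {d : measure_display} {E : measurableType d} (m n : nat).

Definition mx_cylinders : set (set 'M[E]_(m, n)) :=
  [set C | exists (i : 'I_m) (j : 'I_n) (B : set E),
             measurable B /\ C = [set M : 'M[E]_(m, n) | B (M i j)]].

Let mx_set0 : <<s mx_cylinders >> set0.
Proof. exact: sigma_algebra0. Qed.

Let mx_setC A : <<s mx_cylinders >> A -> <<s mx_cylinders >> (~` A).
Proof. exact: sigma_algebraC. Qed.

Let mx_bigcup (F : (set 'M[E]_(m, n))^nat) :
  (forall i, <<s mx_cylinders >> (F i)) ->
  <<s mx_cylinders >> (\bigcup_i (F i)).
Proof. exact: sigma_algebra_bigcup. Qed.

HB.instance Definition _ := @isMeasurable.Build (measure_matrix_display d)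
  'M[E]_(m, n) <<s mx_cylinders >> mx_set0 mx_setC mx_bigcup.

End measurable_matrix.

Section euclidean.
Context {R : realType} {d : nat}.
Implicit Types x y : 'cV[R]_d.

Definition dot x y : R := \sum_i x i 0 * y i 0.

(* The library's norm on matrices is the sup norm, hence this one. *)
Definition enorm x : R := Num.sqrt (dot x x).

(* The zero vector is sent to itself, since 0^-1 = 0. *)
Definition normalize x : 'cV[R]_d := (enorm x)^-1 *: x.

Definition angle x y : R := acos `|dot x y|.

Definition top_unit_eigenvector (S : 'M[R]_d) x :=
  enorm x = 1 /\
  exists s, S *m x = s *: x /\ forall t, eigenvalue S t -> t <= s.

End euclidean.

Section gaussian.
Context {R : realType}.

(* The product measure N(0,1)^m on R^m. *)
Definition std_normal_law (m : nat) (mu : probability 'cV[R]_m R) :=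
  forall B : 'I_m -> set R, (forall i, measurable (B i)) ->
    mu [set z | forall i, B i (z i 0)] =
    (\prod_(i < m) normal_prob 0 1 (B i))%E.

(* X ~ N(0, Sigma): X has the law of A Z, where Z is a standard normal vector
   and A A^T = Sigma.  Sigma is allowed to be singular. *)
Definition normal_vector (disp : measure_display) (T : measurableType disp)
    (P : probability T R) (d : nat) (X : T -> 'cV[R]_d) (Sigma : 'M[R]_d) :=
  exists (m : nat) (A : 'M[R]_(d, m)) (mu : probability 'cV[R]_m R),
    [/\ std_normal_law mu,
        A *m A^T = Sigma &
        forall B : set 'cV[R]_d, measurable B ->
          P (X @^-1` B) = mu [set z | B (A *m z)]].

Definition mutually_independent (disp dispE : measure_display)
    (T : measurableType disp) (E : measurableType dispE)
    (P : probability T R) (n : nat) (X : 'I_n -> T -> E) :=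
  forall B : 'I_n -> set E, (forall j, measurable (B j)) ->
    P [set w | forall j, B j (X j w)] = (\prod_(j < n) P (X j @^-1` B j))%E.

Definition cvg_in_probability (disp : nat -> measure_display)
    (T : forall d, measurableType (disp d)) (P : forall d, probability (T d) R)
    (Y : forall d, T d -> R) (l : R) :=
  forall e : R, 0 < e ->
    (fun d => P d [set w | e < `|Y d w - l|]) @ \oo --> 0%E.

End gaussian.

Section asymptotics.
Context {R : realType}.

Definition same_order (a b : nat -> R) :=
  exists c1 c2 : R, [/\ 0 < c1, c1 <= c2,
    (c1%:E <= limn_einf (fun d => (a d / b d)%:E))%E &
    (limn_esup (fun d => (a d / b d)%:E) <= c2%:E)%E].

Definition dpow (s : R) (d : nat) : R := d%:R `^ s.

End asymptotics.

Section thresholding.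
Context {R : realType}.
Implicit Types lambda y : R.

Definition hard_threshold lambda y : R := if lambda < `|y| then y else 0.

Definition soft_threshold lambda y : R :=
  Num.sg y * Num.max (`|y| - lambda) 0.

Definition scad_threshold (a : R) lambda y : R :=
  if `|y| <= 2 * lambda then Num.sg y * Num.max (`|y| - lambda) 0
  else if `|y| <= a * lambda then
    ((a - 1) * y - Num.sg y * (a * lambda)) / (a - 2)
  else y.

Definition thresholding_function (h : R -> R -> R) :=
  [\/ h = hard_threshold, h = soft_threshold |
      exists a : R, 2 < a /\ h = scad_threshold a].

End thresholding.

Section pca.
Context {R : realType} {d n : nat}.

Definition data_matrix (x : 'I_n -> 'cV[R]_d) : 'M[R]_(d, n) :=
  \matrix_(i, j) x j i 0.

Definition sparse_loading (h : R -> R -> R) (lambda : R)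
    (X : 'M[R]_(d, n)) (v : 'cV[R]_n) : 'cV[R]_d :=
  normalize (map_mx (h lambda) (X *m v)).

(* The component of x orthogonal to u 1; u is indexed from 1 to d. *)
Definition tail_projection (u : nat -> 'cV[R]_d) (x : 'cV[R]_d) : 'cV[R]_d :=
  \sum_(2 <= i < d.+1) dot x (u i) *: u i.

End pca.

(* Main.v *)
Require Import Defs.
From HB Require Import structures.
From mathcomp Require Import all_boot all_order all_algebra.
From mathcomp Require Import all_classical all_reals all_analysis.
From mathcomp Require Import measurable_realfun ring lra.

Set Implicit Arguments.
Unset Strict Implicit.
Unset Printing Implicit Defensive.

Import Order.TTheory GRing.Theory Num.Theory.
Import numFieldNormedType.Exports.

Local Open Scope classical_set_scope.
Local Open Scope ring_scope.

(** Write the data matrix as [M = u a^T + H], where [u] is the first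
    eigenvector, [a j = u . X_j] is the signal and the columns of [H] are the
    components of the samples orthogonal to [u].  Then
    [M v = (a . v) u + H v], and [|M v|^2 = (a . v)^2 + |H v|^2].  The theorem
    follows from three facts.

    Noise.  Each entry of [H] is a centred Gaussian of variance at most
    [lam 2], which is of order [d ^ theta].  By [gaussian_tail_abs] and a union
    bound over the [n d] entries, all of them are below [lambda / n] with
    probability close to 1, since [lambda^2 / d ^ theta] is at least
    [(ln d) ^ (2 delta)] and [2 delta > 1].  Hence every entry of [H v] is at
    most [lambda].

    Signal.  It is not clear that [a . v] is large for the top eigenvector [v]
    of [M^T M], because [|H|^2] may dominate [|a|^2] and then [v] is governed
    by the noise.  Compare [v] with a maximizer [w] of [|H w|] on the unit
    sphere: from [|M v| >= |M w|] and [|H w| >= |H v|] one gets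
    [(a . v)^2 >= (a . w)^2].  The vector [w] depends on [H] only, and [H] is
    independent of [a], so [a . w] is a Gaussian of variance [lam 1], hence
    is not much smaller than [sqrt (lam 1)], of order [d ^ (alpha / 2)].
    To avoid choosing [w] measurably, it is taken in a finite net of the sphere
    so fine that the comparison loses at most 1 ([sphere_net],
    [signal_ge_net]); the independence is used in the form of [small_ball].

    Recovery.  On the support of [u], the entry [(a . v) u_k] exceeds
    [d ^ ((alpha - eta) / 2)] up to a constant, which dominates [lambda]
    because [gamma < alpha - eta].  A thresholding function kills entries below
    [lambda] and moves the others by at most [lambda], so the thresholded
    vector is [(a . v) u] up to a small relative error in each entry, and its
    angle with [u] is small ([cosine_of_relative_error]).

    Everything that concerns Gaussian vectors is deduced from the
    Cameron-Martin formula: translating [X ~ N(0, Sigma)] by [Sigma g]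
    multiplies its law by [exp (g . x - g . Sigma g / 2)]
    ([normal_vector_shift]).  It gives the tail bounds, and it replaces the
    independence of [a] and [H]: a translation along [Sigma u = lam 1 u] moves
    [a] and leaves [H] unchanged. *)

(** The measure structure of a pushforward takes the measurability of the map
    as an argument, which has to be given explicitly. *)
Local Notation pushforward_measure :=
  measure_function_pushforward__canonical__measure_function_Measure.

(** * The Euclidean inner product *)

Section euclidean_facts.
Variable R : realType.

Lemma dotC d (x y : 'cV[R]_d) : dot x y = dot y x.
Proof. by apply: eq_bigr => i _; rewrite mulrC. Qed.

Lemma dot_mxE d (x y : 'cV[R]_d) : dot x y = (x^T *m y) 0 0.
Proof. by rewrite mxE; apply: eq_bigr => i _; rewrite mxE. Qed.

Lemma dot_mulmx m d (A : 'M[R]_(d, m)) x y : dot x (A *m y) = dot (A^T *m x) y.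
Proof. by rewrite !dot_mxE mulmxA trmx_mul trmxK. Qed.

Lemma dotZl d (c : R) (x y : 'cV[R]_d) : dot (c *: x) y = c * dot x y.
Proof. by rewrite mulr_sumr; apply: eq_bigr => i _; rewrite mxE mulrA. Qed.

Lemma dotZr d (c : R) (x y : 'cV[R]_d) : dot x (c *: y) = c * dot x y.
Proof. by rewrite dotC dotZl dotC. Qed.

Lemma dotDr d (x y z : 'cV[R]_d) : dot x (y + z) = dot x y + dot x z.
Proof.
by rewrite /dot -big_split; apply: eq_bigr => i _; rewrite mxE mulrDr.
Qed.

Lemma dotDl d (x y z : 'cV[R]_d) : dot (x + y) z = dot x z + dot y z.
Proof. by rewrite dotC dotDr !(dotC z). Qed.

Lemma dotNr d (x y : 'cV[R]_d) : dot x (- y) = - dot x y.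
Proof. by rewrite -scaleN1r dotZr mulN1r. Qed.

Lemma dotBr d (x y z : 'cV[R]_d) : dot x (y - z) = dot x y - dot x z.
Proof. by rewrite dotDr dotNr. Qed.

Lemma dotBl d (x y z : 'cV[R]_d) : dot (x - y) z = dot x z - dot y z.
Proof. by rewrite dotC dotBr !(dotC z). Qed.

Lemma dotxx_ge0 d (x : 'cV[R]_d) : 0 <= dot x x.
Proof. by apply: sumr_ge0 => i _; rewrite -expr2 sqr_ge0. Qed.

Lemma dotxx_eq0 d (x : 'cV[R]_d) : (dot x x == 0) = (x == 0).
Proof.
apply/idP/eqP => [|->]; last by rewrite /dot big1// => i _; rewrite mxE mul0r.
rewrite psumr_eq0 => [/allP h|i _]; last by rewrite -expr2 sqr_ge0.
apply/colP => i; rewrite mxE; apply/eqP.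
by have := h i (mem_index_enum _); rewrite -expr2 sqrf_eq0.
Qed.

Lemma enorm1P d (x : 'cV[R]_d) : enorm x = 1 <-> dot x x = 1.
Proof.
split=> [h|h]; last by rewrite /enorm h sqrtr1.
by rewrite -[LHS]sqr_sqrtr ?dotxx_ge0// -/(enorm x) h expr1n.
Qed.

Lemma unit_entry_le1 d (x : 'cV[R]_d) i : dot x x = 1 -> `|x i 0| <= 1.
Proof.
move=> x1; rewrite -(@ler_pXn2r _ 2)// ?nnegrE// expr1n -x1 real_normK ?num_real//.
rewrite /dot (bigD1 i)//= -expr2 lerDl sumr_ge0// => j _.
by rewrite -expr2 sqr_ge0.
Qed.

Lemma dot_normalize_le1 d (y u : 'cV[R]_d) : dot u u = 1 ->
  `|dot (normalize y) u| <= 1.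
Proof.
move=> u1; set x := normalize y.
have x1 : dot x x <= 1.
  rewrite /x /normalize dotZl dotZr mulrA.
  have [y0|y0] := eqVneq (dot y y) 0; first by rewrite y0 mulr0.
  have yp : 0 < dot y y by rewrite lt_def y0 dotxx_ge0.
  by rewrite -invfM -expr2 /enorm sqr_sqrtr ?dotxx_ge0// mulVf ?lexx.
clearbody x; have := dotxx_ge0 (x - dot x u *: u).
rewrite dotBl !dotBr !dotZl !dotZr u1 (dotC u x) => h.
rewrite -(@ler_pXn2r _ 2)// ?nnegrE// expr1n real_normK ?num_real//.
by nra.
Qed.

Lemma normalize_lt d (y u : 'cV[R]_d) c : 0 < c ->
  (`|dot (normalize y) u| < c) =
  (dot y y == 0) || (dot y u ^+ 2 < c ^+ 2 * dot y y).
Proof.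
move=> c0; rewrite /normalize dotZl normrM.
have [yy0|yy0] := eqVneq (dot y y) 0.
  by rewrite /enorm yy0 sqrtr0 invr0 normr0 mul0r.
have y0 : 0 < enorm y by rewrite sqrtr_gt0 lt_def yy0 dotxx_ge0.
rewrite normfV (gtr0_norm y0) ltr_pdivrMl// /=.
rewrite -(@ltr_pXn2r _ 2)// ?nnegrE ?mulr_ge0 ?ltW//.
by rewrite exprMn sqr_sqrtr ?dotxx_ge0// real_normK ?num_real// mulrC.
Qed.

End euclidean_facts.

(** * Densities, images and products of measures *)

Section density_measure.
Local Open Scope ereal_scope.
Context d (T : measurableType d) (R : realType).
Variables (mu : {measure set T -> \bar R}) (W : T -> R).
Hypotheses (mW : measurable_fun [set: T] W) (W0 : forall x, (0 <= W x)%R).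

(** The two hypotheses on [W] are arguments so that the measure structure can
    be inferred from the term. *)
Definition density_measure (_ : measurable_fun [set: T] W)
    (_ : forall x, (0 <= W x)%R) (A : set T) : \bar R := \int[mu]_(x in A) (W x)%:E.

Let density0 : density_measure mW W0 set0 = 0.
Proof. exact: integral_set0. Qed.

Let density_ge0 A : 0 <= density_measure mW W0 A.
Proof. by apply: integral_ge0 => x _; rewrite lee_fin. Qed.

Let density_sigma_additive : semi_sigma_additive (density_measure mW W0).
Proof.
move=> F mF tF mUF; rewrite /density_measure ge0_integral_bigcup//; last 2 first.
- by apply: measurable_funTS; exact/measurable_EFinP.
- by move=> x _; rewrite lee_fin.
- apply: is_cvg_ereal_nneg_natsum_cond => n _ _.
  by apply: integral_ge0 => x _; rewrite lee_fin.
Qed.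

HB.instance Definition _ := isMeasure.Build _ _ _
  (density_measure mW W0)
  density0 density_ge0 density_sigma_additive.

End density_measure.

Section density_integral.
Local Open Scope ereal_scope.
Context d (T : measurableType d) d' (E : measurableType d') (R : realType).
Variables (mu : {measure set T -> \bar R}) (W : T -> R) (Y : T -> E).
Variables (m : {measure set E -> \bar R}).
Hypotheses (mW : measurable_fun [set: T] W) (W0 : forall x, (0 <= W x)%R).
Hypothesis mY : measurable_fun [set: T] Y.
Hypothesis mE : forall B, measurable B -> m B = \int[mu]_(x in Y @^-1` B) (W x)%:E.

Import HBNNSimple.

(** Both sides agree on indicators by hypothesis, hence on simple functions,
    hence on their monotone limits. *)
Lemma ge0_integral_density (g : E -> \bar R) :
  measurable_fun [set: E] g -> (forall y, 0 <= g y) ->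
  \int[m]_y g y = \int[mu]_x (g (Y x) * (W x)%:E).
Proof.
move=> mg g0.
have mWE : measurable_fun [set: T] (fun x => (W x)%:E) by exact/measurable_EFinP.
pose f_ := nnsfun_approx measurableT mg.
have mYB B : measurable B -> measurable (Y @^-1` B).
  by move=> mB; rewrite -(setTI (_ @^-1` _)); exact: mY.
transitivity (limn (fun n => \int[m]_x (f_ n x)%:E)).
  rewrite -monotone_convergence//.
  - apply: eq_integral => y _; apply/esym/cvg_lim => //.
    exact: cvg_nnsfun_approx.
  - by move=> n; exact/measurable_EFinP/measurable_funP.
  - by move=> n y _; rewrite lee_fin.
  - by move=> y _ a b ab; rewrite lee_fin; exact/lefP/nd_nnsfun_approx.
have mfY n : measurable_fun [set: T] (fun x => (f_ n (Y x))%:E).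
  by apply/measurable_EFinP; apply: measurableT_comp.
rewrite [X in limn X](_ : _ =
    (fun n => \int[mu]_x ((f_ n (Y x))%:E * (W x)%:E))); last first.
  apply/funext => n.
  transitivity (\sum_(k \in range (f_ n))
      \int[mu]_x ((k * \1_(f_ n @^-1` [set k]) (Y x))%:E * (W x)%:E)); last first.
    rewrite -ge0_integral_fsum//.
    - apply: eq_integral => x _; rewrite [in RHS]fimfunE -fsumEFin//.
      by rewrite ge0_mule_fsuml// => i; rewrite EFinM nnfun_muleindic_ge0.
    - move=> r; apply: emeasurable_funM => //; apply/measurable_EFinP.
      by apply: measurable_funM => //; apply: measurableT_comp.
    - by move=> r x _; apply: mule_ge0; [rewrite EFinM nnfun_muleindic_ge0|rewrite lee_fin].
  under eq_integral do rewrite fimfunE -fsumEFin//.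
  rewrite ge0_integral_fsum//; last 2 first.
  - by move=> y; exact/measurable_EFinP/measurable_funM.
  - by move=> y x _; rewrite EFinM nnfun_muleindic_ge0.
  apply: eq_fsbigr => r /[!inE] -[y _ ry].
  have r0 : (0 <= r)%R by rewrite -ry.
  under [RHS]eq_integral do rewrite EFinM -muleA.
  rewrite [RHS]ge0_integralZl//; last 2 first.
  - apply: emeasurable_funM => //; apply/measurable_EFinP.
    by apply: measurableT_comp.
  - by move=> x _; rewrite mule_ge0 ?lee_fin.
  under eq_integral do rewrite EFinM.
  rewrite ge0_integralZl//; last exact/measurable_EFinP.
  congr (_ * _); rewrite integral_indic// setIT mE//.
  rewrite [LHS]integral_mkcond; apply: eq_integral => x _.
  rewrite patchE indicE; have [hY|hY] := boolP (x \in Y @^-1` _).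
    by rewrite (_ : (Y x \in _) = true) ?mul1e//; move: hY; rewrite !inE.
  rewrite (_ : (Y x \in _) = false) ?mul0e//; apply/negbTE; move: hY.
  by rewrite !notin_setE.
rewrite -monotone_convergence//.
- apply: eq_integral => x _; apply/cvg_lim => //.
  by apply: cvgeZr => //; exact: cvg_nnsfun_approx.
- by move=> n; apply: emeasurable_funM.
- by move=> n x _; rewrite mule_ge0 ?lee_fin.
- by move=> x _ a b ab; rewrite lee_wpmul2r ?lee_fin//; exact/lefP/nd_nnsfun_approx.
Qed.

End density_integral.

Lemma measurable_forall_ord d (T : measurableType d) n (B : 'I_n -> set T) :
  (forall i, measurable (B i)) -> measurable [set x | forall i, B i x].
Proof.
move=> mB; rewrite (_ : [set x | _] = \bigcap_(i in [set: 'I_n]) B i).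
  by apply: fin_bigcap_measurable.
by apply/seteqP; split=> x /= h i //; exact: h.
Qed.

Section independence.
Context d (T : measurableType d) d' (E : measurableType d') (R : realType).
Variables (P : probability T R) (n : nat) (Y : 'I_n -> {RV P >-> E}).
Hypothesis indY : mutually_independent P Y.

(** Independence is this statement for indicators.  The indicators are replaced
    by arbitrary functions one index at a time: with the other factors fixed,
    both sides are measures in the set whose indicator is the factor of index
    [k], and equal measures have equal integrals. *)
Lemma independent_integral_prod (g : 'I_n -> E -> R) (e : 'I_n -> R) :
  (forall i, measurable_fun [set: E] (g i)) -> (forall i x, 0 <= g i x) ->
  (forall i, \int[P]_w (g i (Y i w))%:E = (e i)%:E)%E ->
  (\int[P]_w (\prod_i g i (Y i w))%:E = (\prod_i e i)%:E)%E.
Proof.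
have mYB i B : measurable B -> measurable (Y i @^-1` B).
  by move=> mB; rewrite -(setTI (_ @^-1` _)); exact: (measurable_funP (Y i)).
have intI i B : measurable B ->
    (\int[P]_w (\1_B (Y i w) : R)%:E = P (Y i @^-1` B))%E.
  move=> mB; rewrite -[in RHS](setIT (_ @^-1` _)) -integral_indic//; last exact: mYB.
(* In the induction, the factors of index at least [k] are still indicators. *)
suff step (k : nat) : forall (g : 'I_n -> E -> R) (e : 'I_n -> R),
    (forall i, measurable_fun [set: E] (g i)) -> (forall i x, 0 <= g i x) ->
    (forall i, \int[P]_w (g i (Y i w))%:E = (e i)%:E)%E ->
    (forall i : 'I_n, (k <= i)%N -> exists2 B, measurable B & g i = \1_B) ->
    (\int[P]_w (\prod_i g i (Y i w))%:E = (\prod_i e i)%:E)%E.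
  move=> mg g0 ge; apply: (step n) => // i.
  by rewrite leqNgt ltn_ord.
elim: k => [|k IH] {}g {}e mg g0 ge gI.
  have /choice[B gB] : forall i, exists B, measurable B /\ g i = \1_B.
    by move=> i; have [B mB ->] := gI i (leq0n _); exists B.
  have := indY (fun i => (gB i).1).
  rewrite [X in _ = X -> _](_ : _ = \prod_j (e j)%:E)%E; last first.
    apply: eq_bigr => j _; rewrite -ge (gB j).2; apply/esym/intI.
    exact: (gB j).1.
  rewrite prodEFin => <-.
  rewrite -[X in _ = P X]setIT -[RHS]integral_indic//; last first.
    by apply: measurable_forall_ord => i; apply: mYB; exact: (gB i).1.
  apply: eq_integral => w _; congr EFin; rewrite indicE.
  have [h|h] := boolP (w \in _).
    rewrite big1// => i _; rewrite (gB i).2 indicE mem_set//.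
    by move: h; rewrite inE; apply.
  move: h; rewrite notin_setE => /existsNP[i h].
  by rewrite (bigD1 i)//= (gB i).2 indicE memNset// mul0r.
have [kn|nk] := ltnP k n; last first.
  by apply: IH => // i ki; move: (ltn_ord i); rewrite ltnNge (leq_trans nk ki).
pose k0 := Ordinal kn.
pose W w := \prod_(i | i != k0) g i (Y i w).
pose c := \prod_(i | i != k0) e i.
have e0 i : 0 <= e i.
  by rewrite -lee_fin -ge; apply: integral_ge0 => w _; rewrite lee_fin.
have c0 : 0 <= c by apply: prodr_ge0.
have mW : measurable_fun [set: T] W.
  rewrite /W; under eq_fun do rewrite -big_filter.
  apply: measurable_prod => i _.
  by apply: measurableT_comp.
have W0 w : 0 <= W w by apply: prodr_ge0.
have key B : measurable B ->
    (mscale (NngNum c0) (distribution P (Y k0)) B =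
     \int[P]_(w in Y k0 @^-1` B) (W w)%:E)%E.
  move=> mB.
  pose g' i := if i == k0 then \1_B else g i.
  pose e' i := if i == k0 then fine (P (Y k0 @^-1` B)) else e i.
  have := IH g' e' _ _ _ _.
  rewrite /mscale /= /distribution /pushforward.
  have -> : (\prod_i e' i = c * fine (P (Y k0 @^-1` B))).
    rewrite (bigD1 k0)//= mulrC /e' eqxx; congr (_ * _).
    by apply: eq_bigr => i /negbTE ->.
  rewrite EFinM fineK ?fin_num_measure//; last exact: mYB.
  move=> <-.
  - rewrite [RHS]integral_mkcond; apply: eq_integral => w _.
    rewrite patchE (bigD1 k0)//= {1}/g' eqxx indicE.
    under eq_bigr => i /negbTE hi do rewrite /g' hi.
    have [h|h] := boolP (w \in Y k0 @^-1` B).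
      by rewrite mem_set ?mul1r//; move: h; rewrite inE.
    by rewrite memNset ?mul0r//; move: h; rewrite notin_setE.
  - by move=> i; rewrite /g'; case: ifP => // _; exact: measurable_indic.
  - by move=> i x; rewrite /g'; case: ifP.
  - move=> i; rewrite /g' /e'; case: eqP => [->|//].
    by rewrite intI// fineK ?fin_num_measure//; exact: mYB.
  - move=> i ki; rewrite /g'; case: eqP => [_|/eqP ik]; first by exists B.
    by apply: gI; rewrite ltn_neqAle ki andbT eq_sym; exact: ik.
transitivity (\int[mscale (NngNum c0) (distribution P (Y k0))]_x (g k0 x)%:E)%E.
  rewrite (@ge0_integral_density _ _ _ _ _ P W (Y k0))//; last first.
  - by move=> y; rewrite lee_fin.
  - exact/measurable_EFinP.
  by apply: eq_integral => w _; rewrite (bigD1 k0)//= EFinM.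
rewrite ge0_integral_mscale//; last by move=> x _; rewrite lee_fin.
- rewrite ge0_integral_distribution//.
  + by rewrite [X in (_ * X)%E]ge -EFinM (bigD1 k0)//= mulrC.
  + exact/measurable_EFinP.
  + by move=> y; rewrite lee_fin.
- exact/measurable_EFinP.
Qed.

End independence.

Section matrix_measurability.
Context d (T : measurableType d) d' (E : measurableType d') (m n : nat).

Lemma measurable_fun_mx_entry (i : 'I_m) (j : 'I_n) :
  measurable_fun [set: 'M[E]_(m, n)] (fun M => M i j).
Proof.
move=> _ B mB; rewrite setTI; apply: sub_sigma_algebra.
by exists i, j, B.
Qed.

Lemma measurable_fun_to_mx (F : T -> 'M[E]_(m, n)) :
  (forall i j, measurable_fun [set: T] (fun w => F w i j)) ->
  measurable_fun [set: T] F.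
Proof.
move=> mF; refine (@measurability _ _ T 'M[E]_(m, n) _ F (@mx_cylinders _ E m n) erefl _).
by move=> _ [_ [i [j [B [mB ->]]]] <-]; exact: mF.
Qed.

(** Unlike the cylinders, the rectangles are stable under intersection, as
    uniqueness of measures requires. *)
Definition mx_rectangles : set (set 'M[E]_(m, n)) :=
  [set C | exists B : 'I_m -> 'I_n -> set E,
    (forall i j, measurable (B i j)) /\
    C = [set M : 'M[E]_(m, n) | forall i j, B i j (M i j)]].

Lemma measurable_mx_rectangles :
  @measurable _ 'M[E]_(m, n) = <<s mx_rectangles >>.
Proof.
apply/seteqP; split; last first.
  apply: smallest_sub; first exact: sigma_algebra_measurable.
  move=> _ [B [mB ->]].
  apply: (@measurable_forall_ord _ _ _
    (fun i => [set M : 'M[E]_(m, n) | forall j, B i j (M i j)])) => i.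
  apply: (@measurable_forall_ord _ _ _
    (fun j => [set M : 'M[E]_(m, n) | B i j (M i j)])) => j.
  rewrite -[X in measurable X]setTI.
  exact: measurable_fun_mx_entry.
apply: smallest_sub; first exact: smallest_sigma_algebra.
move=> _ [i [j [B [mB ->]]]]; apply: sub_sigma_algebra.
exists (fun i' j' => if (i' == i) && (j' == j) then B else setT); split.
  by move=> i' j'; case: ifP.
apply/seteqP; split=> M /=.
  by move=> h i' j'; case: ifP => // /andP[/eqP -> /eqP ->].
by move=> /(_ i j); rewrite !eqxx.
Qed.

Lemma setI_closed_mx_rectangles : setI_closed mx_rectangles.
Proof.
move=> _ _ [A [mA ->]] [B [mB ->]]; exists (fun i j => A i j `&` B i j); split.
  by move=> i j; exact: measurableI.
apply/seteqP; split=> M /=; first by move=> [h1 h2] i j; split.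
by move=> h; split=> i j; have [] := h i j.
Qed.

End matrix_measurability.

Section joint_density.
Context d (T : measurableType d) d' (E : measurableType d') (R : realType).
Variables (P : probability T R) (n : nat) (Y : 'I_n -> {RV P >-> E}).
Variables (tau : 'I_n -> E -> E) (f : 'I_n -> E -> R).
Hypothesis indY : mutually_independent P Y.
Hypothesis mtau : forall i, measurable_fun [set: E] (tau i).
Hypothesis mf : forall i, measurable_fun [set: E] (f i).
Hypothesis f0 : forall i x, 0 <= f i x.
Hypothesis tauf : forall i B, measurable B ->
  (P [set w | B (tau i (Y i w))] = \int[P]_(w in Y i @^-1` B) (f i (Y i w))%:E)%E.

(** If translating each coordinate amounts to a change of density, then
    translating all of them amounts to the product of the densities: on
    rectangles this is [independent_integral_prod]. *)
Lemma independent_joint_density (S : set 'cV[E]_n) : measurable S ->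
  (P [set w | S (\col_i tau i (Y i w))] =
   \int[P]_(w in [set w | S (\col_i Y i w)]) (\prod_i f i (Y i w))%:E)%E.
Proof.
have mYB i B : measurable B -> measurable (Y i @^-1` B).
  by move=> mB; rewrite -(setTI (_ @^-1` _)); exact: (measurable_funP (Y i)).
have mtY : measurable_fun [set: T] (fun w => \col_i tau i (Y i w)).
  apply: measurable_fun_to_mx => i j; under eq_fun do rewrite mxE.
  by apply: measurableT_comp.
have mYc : measurable_fun [set: T] (fun w => \col_i Y i w).
  apply: measurable_fun_to_mx => i j; under eq_fun do rewrite mxE.
  exact: measurable_funP.
pose tY : {mfun T >-> 'cV[E]_n} := mfun_Sub (mem_set mtY).
pose Yc : {mfun T >-> 'cV[E]_n} := mfun_Sub (mem_set mYc).
pose W w := \prod_i f i (Y i w).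
have mW : measurable_fun [set: T] W.
  by apply: measurable_prod => i _; apply: measurableT_comp.
have W0 w : 0 <= W w by apply: prodr_ge0.
pose m1 : {measure set _ -> \bar R} := distribution P tY.
move=> mS.
pose dm : {measure set _ -> \bar R} := density_measure P mW W0.
pose m2 : {measure set _ -> \bar R} :=
  pushforward_measure dm mYc.
refine (measure_unique (@mx_rectangles _ E n 1) (fun=> setT) _ _ _ _ m1 m2 _ _ S mS).
- exact: measurable_mx_rectangles.
- exact: setI_closed_mx_rectangles.
- move=> _; exists (fun _ _ => setT); split=> //.
  by apply/seteqP; split.
- by rewrite bigcup_const.
- move=> _ [B [mB ->]].
  rewrite /m1 /m2 /= /distribution /pushforward /= /dm /density_measure.
  have -> : tY @^-1` [set M | forall i j, B i j (M i j)] =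
      [set w | forall i, (tau i @^-1` B i 0) (Y i w)].
    apply/seteqP; split=> w /= h i; first by have := h i 0; rewrite mxE.
    by move=> j; rewrite mxE ord1.
  have mtB i : measurable (tau i @^-1` B i 0).
    by rewrite -[X in measurable X]setTI; exact: mtau.
  have mB0 i : measurable (B i 0) by [].
  rewrite (indY mtB).
  transitivity (\prod_(i < n) (fine (P [set w | B i 0 (tau i (Y i w))]))%:E)%E.
    apply: eq_bigr => i _; rewrite fineK// fin_num_measure//.
    exact: (mYB i _ (mtB i)).
  rewrite prodEFin -(@independent_integral_prod _ _ _ _ _ _ _ _ indY
    (fun i x => \1_(B i 0) x * f i x)).
  + rewrite [RHS]integral_mkcond; apply: eq_integral => w _; rewrite patchE.
    rewrite big_split/=; have [h|h] := boolP (w \in _).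
      rewrite big1 ?mul1r// => i _; rewrite indicE mem_set//.
      by move: h; rewrite inE /= => /(_ i 0); rewrite mxE.
    move: h; rewrite notin_setE /= => /existsNP[i /existsNP[j h]].
    rewrite (bigD1 i)//= indicE memNset ?mul0r//.
    by move: h; rewrite mxE ord1.
  + by move=> i; apply: measurable_funM => //; exact: measurable_indic.
  + by move=> i x; rewrite mulr_ge0.
  + move=> i; rewrite fineK; last first.
      by rewrite fin_num_measure//; exact: (mYB i _ (mtB i)).
    rewrite tauf// [RHS]integral_mkcond; apply: eq_integral => w _.
    rewrite patchE indicE; have [h|h] := boolP (w \in Y i @^-1` _).
      by rewrite mem_set ?mul1r//; move: h; rewrite inE.
    by rewrite memNset ?mul0r//; move: h; rewrite notin_setE.
- by move=> _; rewrite (le_lt_trans (probability_le1 _ _)) ?ltry.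
Qed.


End joint_density.

(** * Translating Gaussian vectors *)

Section image_integral.
Local Open Scope ereal_scope.
Context d (T : measurableType d) d' (E : measurableType d') (R : realType).
Variables (mu : {measure set T -> \bar R}) (m : {measure set E -> \bar R}).
Variable (Y : T -> E).
Hypothesis mY : measurable_fun [set: T] Y.
Hypothesis mE : forall B, measurable B -> m B = mu (Y @^-1` B).

Lemma ge0_integral_image (B : set E) (f : E -> R) : measurable B ->
  measurable_fun [set: E] f -> (forall x, (0 <= f x)%R) ->
  \int[m]_(y in B) (f y)%:E = \int[mu]_(x in Y @^-1` B) (f (Y x))%:E.
Proof.
move=> mB mf f0.
rewrite (@eq_measure_integral _ _ _ B
  (pushforward_measure mu mY)); last first.
  by move=> A mA _; exact: mE.
rewrite ge0_integral_pushforward//.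
- by apply/measurable_EFinP; apply: measurable_funTS.
- by move=> x _; rewrite lee_fin.
Qed.

End image_integral.

Section normal_shift.
Variable R : realType.
Implicit Types (q : R) (B : set R).

Lemma lebesgue_measure_shift q B : measurable B ->
  pushforward (@lebesgue_measure R) (fun x : R => x + q : measurableTypeR R) B =
  lebesgue_measure B.
Proof.
have mq : measurable_fun [set: R] (fun x : R => x + q : measurableTypeR R).
  by apply: measurable_funD.
pose m2 : {measure set (measurableTypeR R) -> \bar R} :=
  pushforward_measure
    (@lebesgue_measure R) mq.
move=> mB; apply/esym; apply: (@lebesgue_measure_unique R m2) => // _ [[a b]] _ <-.
rewrite /m2 /= /pushforward.
have -> : (fun x : R => x + q) @^-1` `]a, b] = `]a - q, b - q]%classic.
  by apply/seteqP; split=> x /=; rewrite !in_itv/= ltrBlDr lerBrDr.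
rewrite !lebesgue_measure_itv/= !lte_fin ltrD2r.
by case: ifP => // _; rewrite -!EFinB; congr EFin; ring.
Qed.

(** Completing the square in the Gaussian density. *)
Lemma normal_prob_shift q B : measurable B ->
  (normal_prob 0 1 [set x | B (x + q)%R] =
   \int[normal_prob 0 1]_(x in B) (expR (q * x - q ^+ 2 / 2))%:E)%E.
Proof.
move=> mB; rewrite [LHS]/normal_prob.
have -> : (\int[lebesgue_measure]_(x in [set x | B (x + q)%R])
      (normal_pdf 0 1 x)%:E =
    \int[lebesgue_measure]_(x in B) (normal_pdf 0 1 (x - q)%R)%:E)%E.
  have mq : measurable_fun [set: R] (fun x : R => x + q : measurableTypeR R).
    by apply: measurable_funD.
  pose m2 : {measure set (measurableTypeR R) -> \bar R} :=
    pushforward_measure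
      (@lebesgue_measure R) mq.
  transitivity (\int[m2]_(x in B) (normal_pdf 0 1 (x - q)%R)%:E)%E; last first.
    by apply: eq_measure_integral => A mA _; exact: lebesgue_measure_shift.
  rewrite /m2 /=.
  rewrite ge0_integral_pushforward//.
  - by apply: eq_integral => x _ /=; rewrite addrK.
  - apply/measurable_EFinP; apply: measurable_funTS; apply: measurableT_comp.
      exact: measurable_normal_pdf.
    by apply: measurable_funD.
  - by move=> x _; rewrite lee_fin normal_pdf_ge0.
rewrite [RHS]integral_mkcond.
rewrite (@ge0_integral_density _ _ _ _ _ lebesgue_measure (normal_pdf 0 1) id
  (normal_prob 0 1))//; [|exact: measurable_normal_pdf| | |]; last 3 first.
- by move=> x; rewrite normal_pdf_ge0.
- apply/(measurable_restrictT _ _).1 => //; apply/measurable_EFinP.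
  apply: measurable_funTS; apply: measurableT_comp => //.
  by apply: measurable_funB => //; apply: measurable_funM.
- by move=> y; rewrite patchE; case: ifP => // _; rewrite lee_fin expR_ge0.
rewrite [LHS]integral_mkcond; apply: eq_integral => x _; rewrite !patchE.
case: ifP => _; last by rewrite mul0e.
rewrite -EFinM; congr EFin; rewrite !normal_pdfE ?oner_neq0// mulrCA -expRD.
by congr (_ * expR _); field.
Qed.

End normal_shift.

Section gaussian_shift.
Variable R : realType.

Lemma measurable_mulmx m n (A : 'M[R]_(m, n)) :
  measurable_fun [set: 'cV[R]_n] (mulmx A : 'cV[R]_n -> 'cV[R]_m).
Proof.
apply: measurable_fun_to_mx => i j; under eq_fun do rewrite mxE.
apply: measurable_sum => k; apply: measurable_funM => //.
exact: measurable_fun_mx_entry.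
Qed.

Lemma measurable_dot n (x : 'cV[R]_n) : measurable_fun [set: 'cV[R]_n] (dot x).
Proof.
apply: measurable_sum => k; apply: measurable_funM => //.
exact: measurable_fun_mx_entry.
Qed.

(** Cameron-Martin for a standard Gaussian vector: its coordinates are
    independent, so the one-dimensional densities multiply. *)
Lemma std_normal_shift m (mu : probability 'cV[R]_m R) (q : 'cV[R]_m) B :
  std_normal_law mu -> measurable B ->
  (mu [set z | B (z + q)%R] =
   \int[mu]_(z in B) (expR (dot q z - dot q q / 2))%:E)%E.
Proof.
move=> mu_std mB.
pose Y i : {RV mu >-> R} := mfun_Sub (mem_set (@measurable_fun_mx_entry _ R m 1 i 0)).
have YE i B' : measurable B' -> mu (Y i @^-1` B') = normal_prob 0 1 B'.
  move=> mB'.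
  have := mu_std (fun k => if k == i then B' else setT).
  rewrite (bigD1 i)//= eqxx big1 ?mule1.
  - move=> <-; first congr (mu _).
      apply/seteqP; split=> z /=; first by move=> h k; case: eqP => [->|].
      by move=> /(_ i); rewrite eqxx.
    by move=> k; case: eqP.
  - by move=> k /negbTE ->; rewrite probability_setT.
have indY : mutually_independent mu Y.
  move=> C mC; have := mu_std C mC => /= ->.
  by apply: eq_bigr => i _; rewrite YE.
have colE z : \col_i Y i z = z by apply/colP => i; rewrite mxE.
transitivity (mu [set w | B (\col_i (Y i w + q i 0))]).
  congr (mu _); apply/seteqP; split=> z /=; suff -> : \col_i (z i 0 + q i 0) = z + q by [].
    by apply/colP => i; rewrite !mxE.
  by apply/colP => i; rewrite !mxE.
rewrite [LHS](@independent_joint_density _ _ _ _ _ mu m Y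
  (fun i x => x + q i 0) (fun i x => expR (q i 0 * x - (q i 0) ^+ 2 / 2))
  indY _ _ _ _ B mB).
- have -> : [set w | B (\col_i Y i w)] = B.
    by apply/seteqP; split=> z /=; rewrite colE.
  apply: eq_integral => z _; congr EFin; rewrite -expR_sum; congr expR.
  rewrite big_split /= sumrN -mulr_suml; congr (_ - _ / _).
- by move=> i; apply: measurable_funD.
- move=> i; apply: measurableT_comp => //.
  by apply: measurable_funB => //; apply: measurable_funM.
- by move=> i x; exact: expR_ge0.
- move=> i B' mB'.
  have mB'q : measurable [set x | B' (x + q i 0)].
    by rewrite -[X in measurable X]setTI; apply: (measurable_funD _ _ measurableT).
  rewrite [LHS](YE i _ mB'q) normal_prob_shift//.
  apply: (@ge0_integral_image _ _ _ _ _ mu (normal_prob 0 1) (Y i)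
    _ _ B' (fun x => expR (q i 0 * x - q i 0 ^+ 2 / 2))) => //.
  - exact: measurable_fun_mx_entry.
  - by move=> C mC; exact/esym/YE.
  - apply: measurableT_comp => //.
    by apply: measurable_funB => //; apply: measurable_funM.
Qed.

Section normal_vector.
Context (disp : measure_display) (T : measurableType disp).
Variables (P : probability T R) (d : nat).

(** Cameron-Martin for [X = A Z]: since [Sigma = A A^T], translating [X] by
    [Sigma g] is translating [Z] by [A^T g]. *)
Lemma normal_vector_shift (X : {RV P >-> 'cV[R]_d}) (Sigma : 'M[R]_d) g B :
  normal_vector P X Sigma -> measurable B ->
  (P [set w | B (X w + Sigma *m g)%R] =
   \int[P]_(w in X @^-1` B)
     (expR (dot g (X w) - dot g (Sigma *m g) / 2))%:E)%E.
Proof.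
move=> [m [A [mu [mu_std <- XE]]]] mB.
pose G (x : 'cV[R]_d) := expR (dot g x - dot g (A *m A^T *m g) / 2).
have mG : measurable_fun [set: 'cV[R]_d] G.
  apply: measurableT_comp => //; apply: measurable_funB => //.
  exact: measurable_dot.
have mAB (C : set 'cV[R]_d) : measurable C ->
    measurable ((mulmx A : 'cV[R]_m -> 'cV[R]_d) @^-1` C).
  by move=> mC; rewrite -[X in measurable X]setTI; exact: (measurable_mulmx A).
have mBs : measurable [set x : 'cV[R]_d | B (x + A *m A^T *m g)].
  rewrite -[X in measurable X]setTI.
  have : measurable_fun [set: 'cV[R]_d] (fun x => x + A *m A^T *m g).
    apply: measurable_fun_to_mx => i j; under eq_fun do rewrite mxE.
    by apply: measurable_funD => //; exact: measurable_fun_mx_entry.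
  by move=> /(_ measurableT _ mB).
rewrite [LHS](XE _ mBs).
rewrite -(@ge0_integral_image _ _ _ _ _ P (distribution P X) X
  (@measurable_funPT _ _ _ _ X) (fun _ _ => erefl) B G)//; last first.
  by move=> x; exact: expR_ge0.
rewrite (@ge0_integral_image _ _ _ _ _ mu (distribution P X) (mulmx A)
  (measurable_mulmx A) XE B G)//; last first.
  by move=> x; exact: expR_ge0.
have -> : [set z | [set x | B (x + A *m A^T *m g)] (A *m z)] =
    [set z | (mulmx A @^-1` B) (z + A^T *m g)].
  by apply/seteqP; split=> z /=; rewrite mulmxDr mulmxA.
rewrite (std_normal_shift _ mu_std); last exact: mAB.
apply: eq_integral => z _; rewrite /G; congr (expR (_ - _ / _))%:E.
  by rewrite dot_mulmx.
by rewrite -mulmxA [RHS]dot_mulmx.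
Qed.

End normal_vector.
End gaussian_shift.

(** * Gaussian tails and small balls *)

Section integral_bounds.
Local Open Scope ereal_scope.
Context d (T : measurableType d) (R : realType).
Variables (mu : {measure set T -> \bar R}) (A : set T) (f : T -> R) (c : R).
Hypotheses (mA : measurable A) (mf : measurable_fun [set: T] f).
Hypothesis f0 : forall x, (0 <= f x)%R.

Lemma ge0_integral_le_cst : (forall x, A x -> (f x <= c)%R) ->
  \int[mu]_(x in A) (f x)%:E <= c%:E * mu A.
Proof.
move=> fc; rewrite -integral_cst//; apply: ge0_le_integral => //.
- by move=> x _; rewrite lee_fin.
- by apply/measurable_EFinP; apply: measurable_funTS.
Qed.

Lemma ge0_integral_ge_cst : (0 <= c)%R -> (forall x, A x -> (c <= f x)%R) ->
  c%:E * mu A <= \int[mu]_(x in A) (f x)%:E.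
Proof.
move=> c0 fc; rewrite -integral_cst//; apply: ge0_le_integral => //.
by apply/measurable_EFinP; apply: measurable_funTS.
Qed.

End integral_bounds.

Section gaussian_estimates.
Variable R : realType.
Context (disp : measure_display) (T : measurableType disp).
Variables (P : probability T R) (d : nat).

Lemma measurable_RV (X : {RV P >-> 'cV[R]_d}) B :
  measurable B -> measurable (X @^-1` B).
Proof.
by move=> mB; rewrite -[X in measurable X]setTI; exact: (measurable_funPT X).
Qed.

Lemma measurable_dot_ge (g : 'cV[R]_d) t :
  measurable [set x | t <= dot g x].
Proof.
rewrite -[X in measurable X]setTI.
by apply: measurable_fun_le => //; exact: measurable_dot.
Qed.

Lemma measurable_dot_RV (X : {RV P >-> 'cV[R]_d}) g :
  measurable_fun [set: T] (fun w => dot g (X w)).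
Proof. by apply: measurableT_comp => //; exact: measurable_dot. Qed.

(** Chernoff's bound.  On the half space the density of the translation by
    [(t / s2) Sigma g] is at least [exp (t^2 / (2 s2))], while its integral is a
    probability. *)
Lemma gaussian_tail (X : {RV P >-> 'cV[R]_d}) (Sigma : 'M[R]_d) g s2 t :
  normal_vector P X Sigma -> 0 < s2 -> dot g (Sigma *m g) <= s2 -> 0 <= t ->
  (P [set w | (t <= dot g (X w))%R] <= (expR (- (t ^+ 2 / (2 * s2))))%:E)%E.
Proof.
move=> hX s20 gs2 t0.
have mB := measurable_dot_ge g t.
have E := normal_vector_shift ((t / s2) *: g) hX mB.
have le1 : ((expR (t ^+ 2 / (2 * s2)))%:E * P (X @^-1` [set x | (t <= dot g x)%R])
    <= 1)%E.
  apply: (@le_trans _ _ (P [set w | [set x | t <= dot g x]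
      (X w + Sigma *m (t / s2 *: g))])); last first.
    apply: probability_le1; rewrite -[X in measurable X]setTI.
    apply: measurable_fun_le => //; under eq_fun do rewrite dotDr.
    by apply: measurable_funD => //; exact: measurable_dot_RV.
  rewrite E; apply: ge0_integral_ge_cst.
  - exact: measurable_RV.
  - apply: measurableT_comp => //; apply: measurable_funB => //.
    exact: measurable_dot_RV.
  - exact: expR_ge0.
  - move=> w /= tw; rewrite ler_expR -scalemxAr !dotZl !dotZr.
    have ts : 0 <= t / s2 by rewrite divr_ge0// ltW.
    apply: (@le_trans _ _ (t / s2 * t - t / s2 * (t / s2 * s2) / 2)).
      by rewrite le_eqVlt; apply/orP; left; apply/eqP; field; rewrite gt_eqF.
    apply: lerB; first exact: ler_wpM2l.
    by rewrite ler_wpM2r// ler_wpM2l// ler_wpM2l.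
have e0 : (0 <= (expR (- (t ^+ 2 / (2 * s2))))%:E :> \bar R)%E.
  by rewrite lee_fin expR_ge0.
have := lee_wpmul2l e0 le1.
by rewrite muleA -EFinM -expRD addNr expR0 mul1e mule1.
Qed.

Lemma gaussian_tail_abs (X : {RV P >-> 'cV[R]_d}) (Sigma : 'M[R]_d) g s2 t :
  normal_vector P X Sigma -> 0 < s2 -> dot g (Sigma *m g) <= s2 -> 0 <= t ->
  (P [set w | (t <= `|dot g (X w)|)%R] <= (2 * expR (- (t ^+ 2 / (2 * s2))))%:E)%E.
Proof.
move=> hX s20 gs2 t0.
have -> : [set w | t <= `|dot g (X w)|] =
    [set w | t <= dot g (X w)] `|` [set w | t <= dot (- g) (X w)].
  apply/seteqP; split=> w /=; rewrite -scaleN1r dotZl mulN1r lerNr.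
    by rewrite lerNr ler_normr => /orP[]; [left|right].
  by rewrite lerNr ler_normr => -[->|->]; rewrite ?orbT.
rewrite (le_trans (measureU2 _ _ _))//.
- exact: (measurable_RV X (measurable_dot_ge _ _)).
- exact: (measurable_RV X (measurable_dot_ge _ _)).
rewrite mulr_natl mulr2n EFinD leeD//; first exact: (gaussian_tail hX).
apply: (gaussian_tail hX) => //.
by rewrite -scaleN1r -scalemxAr dotZl dotZr !mulN1r opprK.
Qed.

End gaussian_estimates.

Section small_ball.
Variable R : realType.
Context (disp : measure_display) (T : measurableType disp).
Variables (P : probability T R) (d n : nat) (X : 'I_n -> {RV P >-> 'cV[R]_d}).
Variables (Sigma : 'M[R]_d) (u : 'cV[R]_d) (l : R).
Hypothesis normalX : forall j, normal_vector P (X j) Sigma.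
Hypothesis indX : mutually_independent P X.
Hypothesis eigu : Sigma *m u = l *: u.
Hypothesis u1 : dot u u = 1.
Hypothesis l0 : 0 < l.

Local Notation sample w := (\col_j X j w).

(** Translating the samples along [u] changes their scores against [u] and
    leaves their components orthogonal to [u] unchanged. *)
Definition shift_along (x : 'cV['cV[R]_d]_n) (s : 'I_n -> R) : 'cV['cV[R]_d]_n :=
  \col_j (x j 0 + s j *: u).

Definition score (w : 'cV[R]_n) (x : 'cV['cV[R]_d]_n) : R :=
  \sum_j w j 0 * dot u (x j 0).

Lemma score_shift w x s :
  score w (shift_along x s) = score w x + \sum_j w j 0 * s j.
Proof.
rewrite /score -big_split; apply: eq_bigr => j _ /=.
by rewrite mxE dotDr dotZr u1 mulr1 mulrDr.
Qed.

Lemma measurable_score w : measurable_fun [set: 'cV['cV[R]_d]_n] (score w).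
Proof.
apply: measurable_sum => j; apply: measurable_funM => //.
apply: measurableT_comp; first exact: measurable_dot.
exact: measurable_fun_mx_entry.
Qed.

Lemma measurable_sample : measurable_fun [set: T] (fun w => sample w).
Proof.
apply: measurable_fun_to_mx => i j; under eq_fun do rewrite mxE.
exact: measurable_funPT.
Qed.

Lemma measurable_sample_preimage S :
  measurable S -> measurable [set w | S (sample w)].
Proof.
move=> mS; rewrite -[X in measurable X]setTI; exact: measurable_sample.
Qed.

(** The direction [w] enters as a weight on the samples, so that [score w]
    moves by [t * sqrt l] exactly, and the density depends on [score w] only. *)
Lemma sample_shift (w : 'cV[R]_n) (t : R) (S : set 'cV['cV[R]_d]_n) :
  dot w w = 1 -> measurable S ->
  (P [set o | S (shift_along (sample o) (fun j => t * w j 0 * Num.sqrt l)%R)] =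
   \int[P]_(o in [set o | S (sample o)])
     (expR (t * (score w (sample o) / Num.sqrt l) - t ^+ 2 / 2))%:E)%E.
Proof.
move=> w1 mS; set s := Num.sqrt l.
have s0 : s != 0 by rewrite gt_eqF// sqrtr_gt0.
have s2 : s * s = l by rewrite -expr2 sqr_sqrtr// ltW.
pose g j := (t * w j 0 / s) *: u.
have Sg j : Sigma *m g j = (t * w j 0 * s) *: u.
  by rewrite -scalemxAr eigu scalerA -s2 mulrA divfK.
pose tau j (x : 'cV[R]_d) := x + Sigma *m g j.
pose f j (x : 'cV[R]_d) := expR (dot (g j) x - dot (g j) (Sigma *m g j) / 2).
have := @independent_joint_density _ _ _ _ _ P n X tau f indX _ _ _ _ S mS.
have -> : [set o | S (\col_i tau i (X i o))] =
    [set o | S (shift_along (sample o) (fun j => t * w j 0 * s))].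
  apply/funext => o; congr S; apply/colP => j; rewrite !mxE /tau Sg.
  by [].
move=> ->.
- apply: eq_integral => o _; congr EFin; rewrite -expR_sum; congr expR.
  rewrite sumrB; congr (_ - _).
    rewrite /score mulrCA mulr_suml; apply: eq_bigr => j _.
    by rewrite mxE dotZl; ring.
  rewrite -mulr_suml; congr (_ / _).
  transitivity (\sum_j t ^+ 2 * (w j 0 * w j 0)).
    by apply: eq_bigr => j _; rewrite Sg dotZl dotZr u1; field.
  by rewrite -mulr_sumr [X in _ * X](_ : _ = 1) ?mulr1.
- move=> j; apply: measurable_fun_to_mx => i k; under eq_fun do rewrite mxE.
  by apply: measurable_funD => //; exact: measurable_fun_mx_entry.
- move=> j; apply: measurableT_comp => //; apply: measurable_funB => //.
  exact: measurable_dot.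
- by move=> j x; exact: expR_ge0.
- by move=> j B mB; exact: normal_vector_shift.
Qed.

(** An event [C] insensitive to translations along [u] behaves as if it were
    independent of [score w].  The [K] windows of radius [1 / (3 K)] about
    [0, 1 / K, 2 / K, ...] are disjoint, so their intersections with [C] have
    total probability at most that of [C]; translating each of them to the
    first one costs a factor [expR 2] at most, because the translations have
    length at most 1. *)
Lemma small_ball_cell (C : set 'cV['cV[R]_d]_n) (w : 'cV[R]_n) (K : nat) :
  measurable C -> (forall x s, C (shift_along x s) <-> C x) ->
  dot w w = 1 -> (0 < K)%N ->
  (P [set o | C (sample o) /\
        (`|score w (sample o)| <= Num.sqrt l / (3 * K%:R))%R] <=
   (expR 2 / K%:R)%:E * P [set o | C (sample o)])%E.
Proof.
move=> mC Cshift w1 K0; set s := Num.sqrt l.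
have s0 : 0 < s by rewrite sqrtr_gt0.
have KR : 0 < K%:R :> R by rewrite ltr0n.
pose ti (k : nat) : R := k%:R / K%:R.
pose S k := [set x | C x /\ `|score w x / s - ti k| <= 1 / (3 * K%:R)].
have mS k : measurable (S k).
  apply: measurableI => //; rewrite -[X in measurable X]setTI.
  apply: measurable_fun_le => //; apply: measurableT_comp => //.
  apply: measurable_funB => //; apply: measurable_funM => //.
  exact: measurable_score.
pose p0 := P [set o | S 0%N (sample o)].
have -> : P [set o | C (sample o) /\ `|score w (sample o)| <= s / (3 * K%:R)] = p0.
  congr (P _); apply/seteqP; split=> o /= -[Co h]; split=> //;
    move: h; rewrite /ti mul0r subr0 normf_div (gtr0_norm s0);
    by rewrite ler_pdivrMr// mul1r mulrC.
have Escore t : \sum_j w j 0 * (t * w j 0 * s) = t * s.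
  transitivity (t * s * dot w w); last by rewrite w1 mulr1.
  by rewrite mulr_sumr; apply: eq_bigr => j _; ring.
have step k : (k < K)%N -> (p0 <= (expR 2)%:E * P [set o | S k (sample o)])%E.
  move=> kK.
  have tk0 : 0 <= ti k by rewrite divr_ge0.
  have tk1 : ti k <= 1 by rewrite ler_pdivrMr// mul1r ler_nat ltnW.
  have -> : p0 = P [set o | S k (shift_along (sample o) (fun j => (ti k * w j 0 * s)%R))].
    congr (P _); apply/seteqP; split=> o /= -[Co h]; split.
    - exact/Cshift.
    - by move: h; rewrite score_shift Escore -/s (mulrDl (score w _)) mulfK ?gt_eqF//
        /ti mul0r subr0 addrK.
    - exact: (Cshift _ _).1 Co.
    - by move: h; rewrite score_shift Escore -/s (mulrDl (score w _)) mulfK ?gt_eqF//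
        /ti mul0r subr0 addrK.
  rewrite (sample_shift _ w1 (mS k)); apply: ge0_integral_le_cst.
  - exact: measurable_sample_preimage.
  - apply: measurableT_comp => //; apply: measurable_funB => //.
    apply: measurable_funM => //; apply: measurable_funM => //.
    by apply: measurableT_comp; [exact: measurable_score|exact: measurable_sample].
  - by move=> o; exact: expR_ge0.
  - move=> o /= [_]; rewrite ler_expR ler_distl -/s => /andP[_ h].
    have e3 : 1 / (3 * K%:R) <= 1 :> R.
      rewrite ler_pdivrMr ?mulr_gt0// mul1r -natrM ler1n.
      by rewrite muln_gt0.
    have h2 := ler_wpM2l tk0 h.
    nra.
have disj : trivIset [set: nat] (fun k => [set o | S k (sample o)]).
  apply/trivIsetP => i j _ _ ij; rewrite -subset0 => o /= [[_ h1] [_ h2]].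
  have : `|ti i - ti j| <= 2 / (3 * K%:R).
    rewrite (le_trans (ler_distD (score w (sample o) / s) _ _))//.
    by rewrite distrC (_ : 2 = 1 + 1)// mulrDl lerD.
  rewrite -mulrBl normrM normfV (gtr0_norm KR) ler_pdivrMr//.
  rewrite [leRHS](_ : _ = 2 / 3); last by field; rewrite gt_eqF.
  suff : 1 <= `|i%:R - j%:R : R| by move=> h3 h4; lra.
  case: (ltngtP i j) ij => // ij _.
  - by rewrite distrC ger0_norm ?subr_ge0 ?ler_nat ?(ltnW ij)//
      -natrB ?(ltnW ij)// ler1n subn_gt0.
  - by rewrite ger0_norm ?subr_ge0 ?ler_nat ?(ltnW ij)//
      -natrB ?(ltnW ij)// ler1n subn_gt0.
have sumle : (\sum_(k < K) P [set o | S k (sample o)] <= P [set o | C (sample o)])%E.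
  have mF k : measurable [set o | S k (sample o)].
    exact: measurable_sample_preimage.
  rewrite -(measure_bigsetU P mF disj K).
  apply: le_measure; rewrite ?inE.
  - apply: bigsetU_measurable => i _; exact: measurable_sample_preimage.
  - exact: measurable_sample_preimage.
  - rewrite -(bigcup_mkord K (fun k => [set o | S k (sample o)])).
    by move=> o [k _ []].
have : (K%:R%:E * p0 <= (expR 2)%:E * P [set o | C (sample o)])%E.
  apply: (@le_trans _ _ (\sum_(k < K) (expR 2)%:E * P [set o | S k (sample o)])%E).
    rewrite [X in (X <= _)%E](_ : _ = \sum_(k < K) p0)%E; last first.
      rewrite -(@fineK _ p0) ?fin_num_measure//; last first.
        exact: measurable_sample_preimage.
      by rewrite sumEFin sumr_const card_ord -EFinM mulr_natl.
    by apply: lee_sum => k _; exact: step.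
  rewrite -ge0_sume_distrr//.
  by apply: lee_wpmul2l => //; rewrite lee_fin expR_ge0.
move=> h; have Ki0 : (0 <= (K%:R^-1)%:E :> \bar R)%E by rewrite lee_fin invr_ge0 ltW.
have := lee_wpmul2l Ki0 h.
by rewrite !muleA -!EFinM mulVf ?gt_eqF// mul1e mulrC.
Qed.

(** The direction may depend on the sample, provided that it is selected by
    functions [F c] insensitive to translations along [u]: one sums
    [small_ball_cell] over the events that [c] is selected. *)
Lemma small_ball (N : nat) (W : nat -> 'cV[R]_n)
    (F : nat -> 'cV['cV[R]_d]_n -> R) (K : nat) :
  (forall c, dot (W c) (W c) = 1) ->
  (forall c, measurable_fun [set: 'cV['cV[R]_d]_n] (F c)) ->
  (forall c x s, F c (shift_along x s) = F c x) ->
  (0 < N)%N -> (0 < K)%N ->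
  exists B : set T, [/\ measurable B, (P B <= (expR 2 / K%:R)%:E)%E &
    forall o, ~ B o -> exists c,
      [/\ (c < N)%N, forall c', (c' < N)%N -> F c' (sample o) <= F c (sample o) &
       Num.sqrt l / (3 * K%:R) < `|score (W c) (sample o)|]].
Proof.
move=> W1 mF Fs N0 K0.
(* [cell k]: [k] is the least maximizer of [F], so that cells are disjoint. *)
pose cell k := [set x | (k < N)%N /\ forall c : 'I_N,
  if (c < k)%N then F c x < F k x else F c x <= F k x].
have mcell k : measurable (cell k).
  have [kN|Nk] := ltnP k N; last first.
    rewrite [X in measurable X](_ : _ = set0)//; apply/seteqP; split=> x //=.
    by move=> -[]; rewrite ltnNge Nk.
  rewrite [X in measurable X](_ : _ = [set x | forall c : 'I_N,
      [set x | if (c < k)%N then F c x < F k x else F c x <= F k x] x]); last first.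
    by apply/seteqP; split=> x /=; [case|split].
  have mle i j : measurable [set x | F i x <= F j x].
    by rewrite -[X in measurable X]setTI; exact: measurable_fun_le.
  apply: measurable_forall_ord => c; case: (c < k)%N => /=; last exact: mle.
  rewrite [X in measurable X](_ : _ = ~` [set x | F k x <= F c x]).
    exact: measurableC.
  by apply/seteqP; split=> x /=; rewrite ltNge => /negP.
have cells k x s : cell k (shift_along x s) <-> cell k x.
  by rewrite /cell /=; split=> -[kN h]; split=> // c; have := h c; rewrite !Fs.
pose bad k := [set o | cell k (sample o) /\
  `|score (W k) (sample o)| <= Num.sqrt l / (3 * K%:R)].
have mbad k : measurable (bad k).
  apply: (@measurable_sample_preimage (cell k `&`
    [set x | `|score (W k) x| <= Num.sqrt l / (3 * K%:R)])).
  apply: measurableI => //; rewrite -[X in measurable X]setTI.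
  apply: measurable_fun_le => //; apply: measurableT_comp => //.
  exact: measurable_score.
have mcs k : measurable [set o | cell k (sample o)].
  exact: measurable_sample_preimage.
have disj : trivIset [set: nat] (fun k => [set o | cell k (sample o)]).
  apply/trivIsetP => i j _ _ ij; rewrite -subset0 => o /= [[iN hi] [jN hj]].
  have {hi} := hi (Ordinal jN); have {hj} := hj (Ordinal iN) => /=.
  case: ltngtP ij => // _ _.
    by move=> /lt_le_trans h /h; rewrite ltxx.
  by move=> /le_lt_trans h /h; rewrite ltxx.
exists (\big[setU/set0]_(k < N) bad k); split.
- by apply: bigsetU_measurable => k _; exact: mbad.
- apply: le_trans (Boole_inequality P (fun i _ => mbad i)) _.
  apply: (@le_trans _ _ (\sum_(k < N) (expR 2 / K%:R)%:E *
      P [set o | cell k (sample o)])%E).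
    by apply: lee_sum => k _; exact: small_ball_cell.
  rewrite -ge0_sume_distrr// -(measure_bigsetU P mcs disj N).
  rewrite -[leRHS]mule1; apply: lee_wpmul2l.
    by rewrite lee_fin divr_ge0// expR_ge0.
  by apply: probability_le1; apply: bigsetU_measurable => k _; exact: mcs.
- move=> o nB; pose x := sample o.
  pose top k := (k < N)%N && [forall c : 'I_N, F c x <= F k x].
  have : exists k, top k.
    pose i0 := Ordinal N0.
    have [i _ hi] := @arg_maxP _ _ _ i0 xpredT (fun i : 'I_N => F i x) isT.
    by exists i; rewrite /top ltn_ord; apply/forallP => c; exact: hi.
  move=> /ex_minnP[k /andP[kN /forallP hk] kmin].
  exists k; split => //; first by move=> c cN; exact: (hk (Ordinal cN)).
  rewrite ltNge; apply/negP => h; apply: nB.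
  rewrite -(bigcup_mkord N bad); exists k => //; split => //; split => // c.
  case: ifPn => [ck|_]; last exact: hk.
  rewrite ltNge; apply/negP => hck.
  suff /kmin : top c by rewrite leqNgt ck.
  rewrite /top ltn_ord; apply/forallP => c'; exact: le_trans (hk c') hck.
Qed.

End small_ball.

(** * Quadratic forms on the unit sphere *)

Section rayleigh.
Variable R : realType.

Lemma continuous_rV_quadratic n (S : 'M[R]_n.+1) :
  continuous (fun r : 'rV[R]_n.+1 => dot r^T (S *m r^T)).
Proof.
have -> : (fun r : 'rV[R]_n.+1 => dot r^T (S *m r^T)) =
    \sum_i \sum_j (fun r : 'rV[R]_n.+1 => S i j * (r 0 i * r 0 j)).
  apply/funext => r; rewrite fct_sumE; apply: eq_bigr => i _.
  rewrite fct_sumE !mxE mulr_sumr; apply: eq_bigr => j _.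
  by rewrite !mxE; ring.
move=> r.
apply: (big_ind (fun f : 'rV[R]_n.+1 -> R => {for r, continuous f})).
- exact: cst_continuous.
- by move=> f g cf cg; apply: continuousD.
move=> i _.
apply: (big_ind (fun f : 'rV[R]_n.+1 -> R => {for r, continuous f})).
- exact: cst_continuous.
- by move=> f g cf cg; apply: continuousD.
move=> j _; apply: continuousM; first exact: cst_continuous.
by apply: continuousM; exact: coord_continuous.
Qed.

(** A zero of a nonnegative quadratic form is a minimum, hence a critical
    point. *)
Lemma psd_null n (S : 'M[R]_n) (y : 'cV[R]_n) : S^T = S ->
  (forall x, 0 <= dot x (S *m x)) -> dot y (S *m y) = 0 -> S *m y = 0.
Proof.
move=> Ssym Spsd Sy0; set z := S *m y.
set b := dot z z; set Q := dot z (S *m z).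
have Q0 : 0 <= Q by exact: Spsd.
have b0 : 0 <= b by exact: dotxx_ge0.
have key t : 0 <= 2 * t * b + t ^+ 2 * Q.
  have := Spsd (y + t *: z).
  rewrite mulmxDr dotDl !dotDr Sy0 -scalemxAr !dotZl !dotZr.
  have -> : dot y (S *m z) = b by rewrite dot_mulmx Ssym.
  by rewrite -/z -/b -/Q => /le_trans; apply; rewrite le_eqVlt; apply/orP; left; apply/eqP; ring.
(* At this [t] the form is negative unless [b = 0]. *)
have Q1 : 0 < Q + 1 by lra.
have := key (- (b / (Q + 1))).
rewrite [X in 0 <= X -> _](_ : _ = - (b ^+ 2 / (Q + 1) ^+ 2 * (Q + 2))); last first.
  by field; rewrite gt_eqF.
rewrite oppr_ge0 => h; apply/eqP; rewrite -dotxx_eq0 -/b -sqrf_eq0.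
have : b ^+ 2 / (Q + 1) ^+ 2 <= 0.
  by rewrite -(pmulr_lle0 _ (_ : 0 < Q + 2))//; lra.
rewrite pmulr_lle0 ?invr_gt0 ?exprn_gt0// => h2.
by rewrite eq_le h2 sqr_ge0.
Qed.

(** The quadratic form has a maximum [m] on the sphere by compactness, and by
    [psd_null] applied to [m - S] a maximizer is an eigenvector for [m]; so [m]
    is at most the largest eigenvalue. *)
Lemma top_eigenvector_max n (S : 'M[R]_n) v w : S^T = S ->
  top_unit_eigenvector S v -> dot w w = 1 -> dot w (S *m w) <= dot v (S *m v).
Proof.
case: n S v w => [|n] S v w Ssym [/enorm1P v1 [s [Sv smax]]] w1.
  by move: w1; rewrite /dot big_ord0 => /eqP; rewrite eq_sym oner_eq0.
pose A := [set r : 'rV[R]_n.+1 | dot r^T r^T = 1].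
pose f (r : 'rV[R]_n.+1) := dot r^T (S *m r^T).
have A0 : A !=set0 by exists w^T; rewrite /A /= trmxK.
have cA : compact A.
  apply: (@subclosed_compact _ A [set r : 'rV[R]_n.+1 | forall i, r 0 i \in `[(-1 : R), 1]]).
  - have -> : A = (fun r : 'rV[R]_n.+1 => dot r^T (1%:M *m r^T)) @^-1` [set 1].
      by apply/seteqP; split=> r /=; rewrite mul1mx.
    apply: closed_comp; last exact: closed_eq.
    by move=> r _; exact: continuous_rV_quadratic.
  - apply: (@rV_compact _ _ (fun=> `[(-1 : R), 1]%classic)) => _.
    exact: segment_compact.
  - move=> r /= r1 i; rewrite in_itv/= -ler_norml.
    by have := unit_entry_le1 i r1; rewrite mxE.
have [y yA ymax] := EVT_max_rV A0 cA
  (continuous_subspaceT (@continuous_rV_quadratic n S)).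
pose m := f y; move: yA; rewrite inE /A /= => y1.
have max1 x : dot x x = 1 -> dot x (S *m x) <= m.
  by move=> x1; have := ymax x^T; rewrite /m /f trmxK; apply; rewrite inE /A /= trmxK.
have maxx x : dot x (S *m x) <= m * dot x x.
  have [->|x0] := eqVneq x 0.
    by rewrite mulmx0 /dot !big1 ?mulr0// => i _; rewrite mxE mul0r.
  have e0 : 0 < dot x x by rewrite lt_def dotxx_ge0 dotxx_eq0 x0.
  pose c := (Num.sqrt (dot x x))^-1.
  have c2 : c * c = (dot x x)^-1 by rewrite -invfM -expr2 sqr_sqrtr// ltW.
  have := max1 (c *: x).
  rewrite -scalemxAr !dotZl !dotZr !mulrA c2 mulVf ?gt_eqF// => /(_ erefl).
  by rewrite ler_pdivrMl// mulrC.
have Sy : (m%:M - S) *m y^T = 0.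
  apply: psd_null.
  - by rewrite linearB /= tr_scalar_mx Ssym.
  - move=> x; rewrite mulmxBl mul_scalar_mx dotBr dotZr subr_ge0; exact: maxx.
  - by rewrite mulmxBl mul_scalar_mx dotBr dotZr y1 mulr1 subrr.
have mS : eigenvalue S m.
  apply/eigenvalueP; exists y; last first.
    by apply/eqP => y0; move: y1; rewrite y0 /dot big1 => [/eqP|i _];
      rewrite ?mxE ?mul0r// eq_sym oner_eq0.
  apply: trmx_inj; rewrite trmx_mul Ssym linearZ /=.
  by apply/esym/eqP; rewrite -subr_eq0 -mul_scalar_mx -mulmxBl Sy.
rewrite Sv dotZr v1 mulr1; exact: le_trans (max1 _ w1) (smax _ mS).
Qed.

End rayleigh.

Section net_and_spectrum.
Variable R : realType.

(** Cut the cube containing the sphere into boxes of side [delta], and take a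
    unit vector in each box that contains one. *)
Lemma sphere_net n (delta : R) : (0 < n)%N -> 0 < delta ->
  exists N (W : nat -> 'cV[R]_n), [/\ (0 < N)%N,
    forall c, dot (W c) (W c) = 1 &
    forall v, dot v v = 1 ->
      exists2 c, (c < N)%N & forall i, `|W c i 0 - v i 0| <= delta].
Proof.
move=> n0 delta0.
pose e : 'cV[R]_n := delta_mx (Ordinal n0) 0.
have e1 : dot e e = 1.
  rewrite /dot (bigD1 (Ordinal n0))//= big1 ?addr0.
    by rewrite mxE !eqxx mulr1.
  by move=> i /negbTE ni; rewrite mxE ni mul0r.
pose m := (Num.truncn (2 / delta)).+1.
pose code (v : 'cV[R]_n) : {ffun 'I_n -> 'I_m} :=
  [ffun i => inord (Num.truncn ((v i 0 + 1) / delta))].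
have codeP v v' : dot v v = 1 -> dot v' v' = 1 -> code v = code v' ->
    forall i, `|v i 0 - v' i 0| <= delta.
  move=> v1 v1' /ffunP h i.
  have bnd x : dot x x = 1 -> 0 <= (x i 0 + 1) / delta /\
      (Num.truncn ((x i 0 + 1) / delta)%R < m)%N.
    move=> /(unit_entry_le1 i); rewrite ler_norml => /andP[h1 h2].
    have h0 : 0 <= (x i 0 + 1) / delta.
      by apply: divr_ge0; [lra|exact: ltW].
    split=> //; rewrite /m ltnS; apply: le_truncn.
    by rewrite ler_pM2r ?invr_gt0//; lra.
  have := h i; rewrite !ffunE => /(congr1 val); rewrite /= !inordK; last 2 first.
  - by have [] := bnd _ v1'.
  - by have [] := bnd _ v1.
  move=> ht.
  have [a0 _] := bnd _ v1; have [b0 _] := bnd _ v1'.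
  have /andP[a1 a2] := truncn_itv a0; have /andP[b1 b2] := truncn_itv b0.
  rewrite ht -natr1 in a1 a2; rewrite -natr1 in b2.
  have : `|(v i 0 + 1) / delta - (v' i 0 + 1) / delta| <= 1.
    by rewrite ler_norml; apply/andP; split; lra.
  rewrite -mulrBl normrM normfV (gtr0_norm delta0) ler_pdivrMr// mul1r.
  by rewrite (_ : _ - _ = v i 0 - v' i 0)//; ring.
have /choice[rep repP] : forall f : {ffun 'I_n -> 'I_m}, exists w,
    dot w w = 1 /\ forall v, dot v v = 1 -> code v = f -> code w = f.
  move=> f; have [[v [v1 vf]]|nv] := pselect (exists v, dot v v = 1 /\ code v = f).
    by exists v.
  by exists e; split=> // v v1 vf; exfalso; apply: nv; exists v.
pose f0 : {ffun 'I_n -> 'I_m} := [ffun=> ord0].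
exists #|{ffun 'I_n -> 'I_m}|, (fun c => rep (nth f0 (enum {ffun 'I_n -> 'I_m}) c)).
split.
- by apply/card_gt0P; exists f0.
- by move=> c; have [] := repP (nth f0 (enum {ffun 'I_n -> 'I_m}) c).
- move=> v v1; exists (enum_rank (code v)); first exact: ltn_ord.
  have -> : nth f0 (enum {ffun 'I_n -> 'I_m}) (enum_rank (code v)) = code v.
    exact: nth_enum_rank.
  have [w1 wP] := repP (code v).
  by move=> i; apply: codeP => //; exact: (wP v).
Qed.

(** Expand [p] in the orthonormal eigenbasis: the coefficient on [u 1] is
    zero and the other eigenvalues are at most [L]. *)
Lemma eigenbasis_quadratic_le d (Sigma : 'M[R]_d) (lam : nat -> R)
    (u : nat -> 'cV[R]_d) (L : R) (p : 'cV[R]_d) :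
  (forall i, (1 <= i <= d)%N -> Sigma *m u i = lam i *: u i) ->
  (forall i j, (1 <= i <= d)%N -> (1 <= j <= d)%N ->
    dot (u i) (u j) = (i == j)%:R) ->
  (forall i, (2 <= i <= d)%N -> lam i <= L) ->
  dot (u 1%N) p = 0 -> dot p (Sigma *m p) <= L * dot p p.
Proof.
move=> eig orth lamL p1.
pose U : 'M[R]_d := \matrix_(k, i) u i.+1 k 0.
have colU i : col i U = u i.+1 by apply/colP => k; rewrite !mxE.
have UU : U^T *m U = 1%:M.
  apply/matrixP => i j; rewrite !mxE -(orth i.+1 j.+1)//=.
  by apply: eq_bigr => k _; rewrite !mxE.
pose c := U^T *m p.
have Uc : U *m c = p by rewrite mulmxA (mulmx1C UU) mul1mx.
have cE i : c i 0 = dot (u i.+1) p.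
  by rewrite mxE; apply: eq_bigr => k _; rewrite !mxE.
pose D := diag_mx (\row_i lam i.+1) : 'M[R]_d.
have SU : Sigma *m U = U *m D.
  apply/matrixP => k i.
  have /colP/(_ k) := eig i.+1 (ltn_ord i); rewrite mul_mx_diag !mxE => E.
  rewrite mulrC -E; apply: eq_bigr => j _; rewrite !mxE; congr (_ * _).
have -> : dot p (Sigma *m p) = \sum_(i < d) lam i.+1 * c i 0 ^+ 2.
  rewrite -Uc mulmxA SU -mulmxA dot_mulmx mulmxA UU mul1mx.
  apply: eq_bigr => i _; rewrite mul_diag_mx !mxE; ring.
have -> : dot p p = \sum_(i < d) c i 0 ^+ 2.
  rewrite -{1}Uc dotC dot_mulmx; apply: eq_bigr => i _; by rewrite expr2.
rewrite mulr_sumr; apply: ler_sum => i _.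
have [i0|i0] := posnP i.
  by rewrite cE i0 p1 expr0n /= !mulr0.
by rewrite ler_wpM2r ?sqr_ge0// lamL// ltnS i0 ltn_ord.
Qed.

End net_and_spectrum.

(** * Thresholding a signal plus small noise *)

Section thresholding_facts.
Variable R : realType.
Implicit Types (lam y : R).

(** A form without signs, from which measurability and the distance to the
    identity are read off. *)
Lemma soft_thresholdE lam y : 0 <= lam ->
  soft_threshold lam y = Num.max (y - lam) 0 - Num.max (- y - lam) 0.
Proof.
move=> lam0; rewrite /soft_threshold.
have [y0|y0|->] := ltrgt0P y.
- rewrite gtr0_sg// mul1r (_ : Num.max (- y - lam) 0 = 0) ?subr0//.
  by rewrite max_r//; lra.
- rewrite ltr0_sg// mulN1r (_ : Num.max (y - lam) 0 = 0) ?sub0r//.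
  by rewrite max_r//; lra.
- by rewrite sgr0 mul0r oppr0 subrr.
Qed.

Lemma soft_threshold_small lam y : `|y| <= lam -> soft_threshold lam y = 0.
Proof.
by move=> h; rewrite /soft_threshold max_r ?mulr0// subr_le0.
Qed.

Lemma soft_threshold_dist lam y : 0 <= lam -> `|soft_threshold lam y - y| <= lam.
Proof.
move=> lam0; rewrite soft_thresholdE// ler_norml.
by have [|] := leP (y - lam) 0; have [|] := leP (- y - lam) 0 => h1 h2;
  apply/andP; split; lra.
Qed.

Lemma measurable_soft_threshold lam : 0 <= lam ->
  measurable_fun [set: R] (soft_threshold lam).
Proof.
move=> lam0; rewrite (_ : soft_threshold lam = fun y =>
    Num.max (y - lam) 0 - Num.max (- y - lam) 0); last first.
  by apply/funext => y; rewrite soft_thresholdE.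
apply: measurable_funB; apply: measurable_maxr => //.
  exact: measurable_funB.
by apply: measurable_funB => //; exact: measurableT_comp.
Qed.

Lemma measurable_le_bool d (T : measurableType d) (f g : T -> R) :
  measurable_fun [set: T] f -> measurable_fun [set: T] g ->
  measurable_fun [set: T] (fun x => f x <= g x).
Proof. by move=> mf mg; exact: measurable_fun_ler. Qed.

(** All that is used of the three thresholding functions. *)
Lemma thresholding_functionP (h : R -> R -> R) : thresholding_function h ->
  forall lam, 0 <= lam ->
  [/\ forall y, `|y| <= lam -> h lam y = 0,
      forall y, `|h lam y - y| <= lam &
      measurable_fun [set: R] (h lam)].
Proof.
have mn : measurable_fun [set: R] (fun y : R => `|y|) by exact: measurableT_comp.
move=> [->|->|[a [a2 ->]]] lam lam0; split.
- by move=> y yl; rewrite /hard_threshold ltNge yl.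
- move=> y; rewrite /hard_threshold; case: ltP => yl; first by rewrite subrr normr0.
  by rewrite sub0r normrN.
- apply: measurable_fun_ifT => //.
  exact: measurable_fun_ltr.
- exact: soft_threshold_small.
- by move=> y; exact: soft_threshold_dist.
- exact: measurable_soft_threshold.
- move=> y yl; rewrite /scad_threshold (le_trans yl) ?soft_threshold_small//.
    exact: soft_threshold_small.
  by lra.
- move=> y; rewrite /scad_threshold; case: ifPn => [y2|].
    exact: soft_threshold_dist.
  rewrite -ltNge => y2; case: ifPn => ya; last by rewrite subrr normr0.
  have a20 : 0 < a - 2 by lra.
  have -> : ((a - 1) * y - Num.sg y * (a * lam)) / (a - 2) - y =
      (y - Num.sg y * (a * lam)) / (a - 2) by field; rewrite gt_eqF.
  rewrite normrM normfV (gtr0_norm a20) ler_pdivrMr//.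
  move: y2 ya; have [y0|y0|->] := ltrgt0P y => y2 ya.
  + by rewrite gtr0_sg// ler_norml; apply/andP; split; nra.
  + by rewrite ltr0_sg// ler_norml; apply/andP; split; nra.
  + by lra.
- apply: measurable_fun_ifT.
  + by apply: measurable_le_bool.
  + exact: measurable_soft_threshold.
  apply: measurable_fun_ifT => //.
  + by apply: measurable_le_bool.
  apply: measurable_funM => //; apply: measurable_funB.
    by apply: measurable_funM.
  apply: measurable_funM => //.
  rewrite (_ : Num.sg = fun y : R => if 0 < y then 1 else if y < 0 then -1 else 0).
    apply: measurable_fun_ifT => //; first exact: measurable_fun_ltr.
    by apply: measurable_fun_ifT => //; exact: measurable_fun_ltr.
  by apply/funext => y; have [y0|y0|->] := ltrgt0P y; rewrite ?(gtr0_sg y0) ?(ltr0_sg y0) ?sgr0 ?ltxx //.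
Qed.

End thresholding_facts.

Section recovery.
Variable R : realType.

(** Summing the entrywise errors gives [|y . u| >= (1 - r) |s|] and
    [|y| <= (1 + r) |s|]. *)
Lemma cosine_of_relative_error d (u y : 'cV[R]_d) (s r : R) :
  dot u u = 1 -> s != 0 -> 0 <= r < 1 ->
  (forall k, `|y k 0 - s * u k 0| <= r * `|s| * `|u k 0|) ->
  (1 - r) / (1 + r) <= `|dot (normalize y) u|.
Proof.
move=> u1 s0 /andP[r0 r1] yu.
have s'0 : 0 < `|s| by rewrite normr_gt0.
have num : `|s| * (1 - r) <= `|dot y u|.
  have -> : dot y u = s + \sum_k (y k 0 - s * u k 0) * u k 0.
    rewrite -[X in X + _]mulr1 -u1 mulr_sumr -big_split; apply: eq_bigr => k _ /=.
    by ring.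
  have : `|\sum_k (y k 0 - s * u k 0) * u k 0| <= r * `|s|.
    rewrite -[leRHS]mulr1 -u1 mulr_sumr; apply: le_trans (ler_norm_sum _ _ _) _.
    apply: ler_sum => k _; rewrite normrM.
    rewrite (_ : u k 0 * u k 0 = `|u k 0| * `|u k 0|).
      by rewrite mulrA ler_wpM2r.
    by rewrite -normrM ger0_norm// -expr2 sqr_ge0.
  set e := \sum_k _ => he.
  have := ler_normB (s + e) e; rewrite addrK => h.
  by lra.
have den : dot y y <= (`|s| * (1 + r)) ^+ 2.
  rewrite -[leRHS]mulr1 -u1 mulr_sumr; apply: ler_sum => k _.
  rewrite -!expr2 -exprMn -[leLHS]real_normK ?num_real//.
  rewrite -[leRHS]real_normK ?num_real//.
  rewrite ler_pXn2r ?nnegrE// normrM (ger0_norm (_ : 0 <= `|s| * _)); last first.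
    by rewrite mulr_ge0//; lra.
  have := ler_normD (y k 0 - s * u k 0) (s * u k 0); rewrite subrK normrM => h.
  have := yu k; nra.
have y0 : 0 < enorm y.
  rewrite sqrtr_gt0 lt_def dotxx_ge0 andbT dotxx_eq0; apply/eqP => yz.
  move: num; rewrite yz /dot big1 ?normr0; last by move=> i _; rewrite mxE mul0r.
  by rewrite leNgt mulr_gt0//; lra.
have yle : enorm y <= `|s| * (1 + r).
  rewrite -(@ler_pXn2r _ 2) ?nnegrE ?(ltW y0)//; last by rewrite mulr_ge0//; lra.
  by rewrite sqr_sqrtr ?dotxx_ge0.
rewrite /normalize dotZl normrM normfV (gtr0_norm y0) [leRHS]mulrC.
rewrite ler_pdivlMr//; apply: le_trans num.
rewrite mulrAC ler_pdivrMr; last by lra.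
have r1' : 0 <= 1 - r by lra.
have := ler_wpM2l r1' yle.
by lra.
Qed.

Section noise_decomposition.
Variables (d n : nat) (M : 'M[R]_(d, n)) (u : 'cV[R]_d) (tau : R).
Hypothesis u1 : dot u u = 1.
Let a := M^T *m u.
(** The columns of [noise_mx] are the components of the columns of [M]
    orthogonal to [u]. *)
Definition noise_mx := M - u *m a^T.
Hypothesis noise_le : forall k j, `|noise_mx k j| <= tau.

Lemma mulmx_noise x : M *m x = dot a x *: u + noise_mx *m x.
Proof.
rewrite mulmxBl addrCA -mulmxA.
have -> : a^T *m x = (dot a x)%:M.
  by rewrite [LHS]mx11_scalar dot_mxE.
by rewrite mul_mx_scalar subrr addr0.
Qed.

Lemma dot_noise x : dot u (noise_mx *m x) = 0.
Proof.
have := congr1 (dot u) (mulmx_noise x).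
rewrite dotDr dotZr u1 mulr1 dot_mulmx -/a => /eqP.
by rewrite -subr_eq0 opprD addrA subrr sub0r oppr_eq0 => /eqP.
Qed.

Lemma energy_split x :
  dot (M *m x) (M *m x) = dot a x ^+ 2 + dot (noise_mx *m x) (noise_mx *m x).
Proof.
rewrite mulmx_noise dotDl !dotDr !dotZl !dotZr u1 dot_noise (dotC _ u) dot_noise.
by ring.
Qed.

Lemma noise_entry_le (x : 'cV[R]_n) k : (forall j, `|x j 0| <= 1) ->
  `|(noise_mx *m x) k 0| <= n%:R * tau.
Proof.
move=> x1; rewrite mxE; apply: le_trans (ler_norm_sum _ _ _) _.
rewrite -[n in n%:R]card_ord mulr_natl -sumr_const; apply: ler_sum => j _.
by rewrite normrM -[leRHS]mulr1 ler_pM.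
Qed.

Lemma noise_energy_close x w delta : dot x x = 1 -> dot w w = 1 ->
  0 <= delta -> (forall j, `|w j 0 - x j 0| <= delta) ->
  dot (noise_mx *m x) (noise_mx *m x) <=
  dot (noise_mx *m w) (noise_mx *m w) + d%:R * (2 * n%:R ^+ 2 * tau ^+ 2 * delta).
Proof.
move=> x1 w1 delta0 wx.
rewrite -[d in d%:R]card_ord mulr_natl -sumr_const -big_split /=.
apply: ler_sum => k _.
have hx := noise_entry_le k (fun j => unit_entry_le1 j x1).
have hw := noise_entry_le k (fun j => unit_entry_le1 j w1).
have hd : `|(noise_mx *m x) k 0 - (noise_mx *m w) k 0| <= n%:R * tau * delta.
  rewrite !mxE -sumrB; apply: le_trans (ler_norm_sum _ _ _) _.
  rewrite -mulrA -[n in n%:R]card_ord mulr_natl -sumr_const; apply: ler_sum => j _.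
  by rewrite -mulrBr normrM distrC ler_pM.
set A := (noise_mx *m x) k 0 in hx hd *; set B := (noise_mx *m w) k 0 in hw hd *.
rewrite -lerBlDl.
have -> : A * A - B * B = (A - B) * (A + B) by ring.
apply: le_trans (ler_norm _) _; rewrite normrM.
have hAB : `|A + B| <= 2 * (n%:R * tau).
  by apply: le_trans (ler_normD _ _) _; lra.
apply: le_trans (ler_pM _ _ hd hAB) _ => //.
by rewrite le_eqVlt; apply/orP; left; apply/eqP; ring.
Qed.

(** If [W c] maximizes the noise energy over the net, its signal is not larger
    than that of the maximizer [v] of the total energy, up to the variation of
    the noise energy between [v] and the nearest point of the net. *)
Lemma signal_ge_net v N (W : nat -> 'cV[R]_n) delta c :
  dot v v = 1 ->
  (forall w, dot w w = 1 -> dot (M *m w) (M *m w) <= dot (M *m v) (M *m v)) ->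
  (forall c, dot (W c) (W c) = 1) -> 0 <= delta ->
  (forall v, dot v v = 1 ->
    exists2 c, (c < N)%N & forall i, `|W c i 0 - v i 0| <= delta) ->
  (forall c', (c' < N)%N -> dot (noise_mx *m W c') (noise_mx *m W c') <=
    dot (noise_mx *m W c) (noise_mx *m W c)) ->
  dot a (W c) ^+ 2 - d%:R * (2 * n%:R ^+ 2 * tau ^+ 2 * delta) <= dot a v ^+ 2.
Proof.
move=> v1 vmax W1 delta0 net cmax.
have := vmax _ (W1 c); rewrite !energy_split.
have [c' c'N hc'] := net v v1.
have := noise_energy_close v1 (W1 c') delta0 hc'.
have := cmax c' c'N.
by lra.
Qed.

(** Off the support of [u] an entry is pure noise, at most [lam], and is set
    to zero.  On the support the noise and the thresholding move it by at most
    [2 lam], which is a fraction [r] of the signal there. *)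
Lemma sparse_loading_cosine v h lam L r :
  thresholding_function h -> 0 <= lam -> n%:R * tau <= lam ->
  dot v v = 1 -> (forall k, u k 0 != 0 -> `|u k 0|^-1 <= L) ->
  0 < `|dot a v| -> 0 <= r < 1 -> 2 * lam * L <= r * `|dot a v| ->
  (1 - r) / (1 + r) <= `|dot (sparse_loading h lam M v) u|.
Proof.
move=> hh lam0 ntau v1 uL s0 r01 lamL.
have [h0 h1 _] := thresholding_functionP hh lam0.
apply: (@cosine_of_relative_error _ _ _ (dot a v)) => //.
  by rewrite -normr_gt0.
move=> k; rewrite mxE mulmx_noise mxE [(_ *: u) k 0]mxE.
have e := le_trans (noise_entry_le k (fun j => unit_entry_le1 j v1)) ntau.
set eps := (noise_mx *m v) k 0 in e *.
have [uk|uk] := eqVneq (u k 0) 0.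
  by rewrite uk mulr0 add0r h0// subr0 normr0 mulr0.
have ukp : 0 < `|u k 0| by rewrite normr_gt0.
have L1 : 1 <= L * `|u k 0| by rewrite -ler_pdivrMr// mul1r uL.
set s := dot a v in s0 lamL *.
apply: (@le_trans _ _ (2 * lam)).
  have := h1 (s * u k 0 + eps).
  have := ler_normD (h lam (s * u k 0 + eps) - (s * u k 0 + eps)) eps.
  rewrite (_ : _ - _ + eps = h lam (s * u k 0 + eps) - s * u k 0); last by ring.
  by lra.
apply: (@le_trans _ _ (2 * lam * (L * `|u k 0|))).
  by rewrite ler_peMr//; lra.
by rewrite mulrA ler_wpM2r.
Qed.

End noise_decomposition.
End recovery.

(** * The probability of a bad angle in a fixed dimension *)

Section union_bound.
Local Open Scope ereal_scope.
Context d (T : measurableType d) (R : realType) (P : probability T R).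

Lemma measurable_exists_ord m (A : 'I_m -> set T) :
  (forall i, measurable (A i)) -> measurable [set w | exists i, A i w].
Proof.
move=> mA; rewrite (_ : [set w | _] = \bigcup_(i in [set: 'I_m]) A i).
  by apply: fin_bigcup_measurable.
by apply/seteqP; split=> w /= [i]; exists i.
Qed.

Lemma union_bound m (A : 'I_m -> set T) (c : R) :
  (forall i, measurable (A i)) -> (forall i, P (A i) <= c%:E) ->
  P [set w | exists i, A i w] <= (m%:R * c)%:E.
Proof.
elim: m A => [|m IH] A mA Ac.
  rewrite mul0r (_ : [set w | _] = set0) ?measure0//.
  by apply/seteqP; split=> w //= [[]].
rewrite (_ : [set w | _] = A ord0 `|` [set w | exists i, A (lift ord0 i) w]).
  apply: le_trans (measureU2 _ _ _) _ => //.
    exact: measurable_exists_ord.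
  rewrite -natr1 mulrDl mul1r EFinD [leLHS]addeC; apply: leeD; last exact: Ac.
  by apply: (IH (fun i => A (lift ord0 i))) => i; [exact: mA|exact: Ac].
apply/seteqP; split=> w /=.
  by move=> [i]; case: (unliftP ord0 i) => [j ->|->]; [right; exists j|left].
by move=> [h|[i h]]; [exists ord0|exists (lift ord0 i)].
Qed.

End union_bound.

Section cosine_probability.
Variable R : realType.

Context (disp : measure_display) (T : measurableType disp).
Variables (P : probability T R) (d n : nat) (X : 'I_n -> {RV P >-> 'cV[R]_d}).
Variables (v1 : {RV P >-> 'cV[R]_n}) (h : R -> R -> R) (lam : R) (u : 'cV[R]_d).
Hypothesis hh : thresholding_function h.
Hypothesis lam0 : 0 <= lam.

Local Notation M w := (data_matrix (fun j => X j w)).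
Local Notation loading w := (sparse_loading h lam (M w) (v1 w)).

(** Written without division, the condition is an inequality between
    measurable functions; the null vector is treated apart. *)
Lemma measurable_loading_lt c :
  measurable [set w | `|dot (loading w) u| < c].
Proof.
have [c0|c0] := leP c 0.
  rewrite (_ : [set w | _] = set0)//; apply/seteqP; split=> w //=.
  by rewrite ltNge (le_trans c0).
have [_ _ mh] := thresholding_functionP hh lam0.
pose y w : 'cV[R]_d := map_mx (h lam) (M w *m v1 w).
have my : measurable_fun [set: T] y.
  apply: measurable_fun_to_mx => i j; under eq_fun do rewrite !mxE.
  apply: measurableT_comp => //; apply: measurable_sum => k.
  apply: measurable_funM.
    under eq_fun do rewrite mxE.
    exact: (measurableT_comp (@measurable_fun_mx_entry _ R d 1 i 0)
      (@measurable_funPT _ _ _ _ (X k))).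
  exact: (measurableT_comp (@measurable_fun_mx_entry _ R n 1 k j)
    (@measurable_funPT _ _ _ _ v1)).
have myk k : measurable_fun [set: T] (fun w => y w k 0).
  exact: (measurableT_comp (@measurable_fun_mx_entry _ R d 1 k 0) my).
have myy : measurable_fun [set: T] (fun w => dot (y w) (y w)).
  by apply: measurable_sum => k; apply: measurable_funM.
have myu : measurable_fun [set: T] (fun w => dot (y w) u).
  by apply: measurable_sum => k; apply: measurable_funM.
rewrite (_ : [set w | _] = [set w | dot (y w) (y w) <= 0] `|`
    ~` [set w | c ^+ 2 * dot (y w) (y w) <= dot (y w) u ^+ 2]); last first.
  apply/seteqP; split=> w /=; rewrite normalize_lt// -/(y w).
    move=> /orP[/eqP ->|h']; [by left|right].
    by apply/negP; rewrite -ltNge.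
  move=> [h'|/negP]; first by rewrite eq_le h' dotxx_ge0.
  by rewrite -ltNge => ->; rewrite orbT.
apply: measurableU; last apply: measurableC.
  rewrite -[X in measurable X]setTI.
  exact: measurable_fun_le.
rewrite -[X in measurable X]setTI.
apply: measurable_fun_le => //; first exact: measurable_funM.
by apply: measurable_funX.
Qed.

Variables (Sigma : 'M[R]_d) (l s2 : R).
Hypothesis normalX : forall j, normal_vector P (X j) Sigma.
Hypothesis indX : mutually_independent P X.
Hypothesis eigu : Sigma *m u = l *: u.
Hypothesis u1 : dot u u = 1.
Hypothesis l0 : 0 < l.
Hypothesis s20 : 0 < s2.
Hypothesis Sigma_le : forall p, dot u p = 0 -> dot p (Sigma *m p) <= s2 * dot p p.
Hypothesis v1_top : forall w, top_unit_eigenvector ((M w)^T *m M w) (v1 w).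
Hypothesis n0 : (0 < n)%N.

(** The rows of the orthogonal projection off [u]: [coord_proj k . x] is entry
    [k] of the component of [x] orthogonal to [u]. *)
Let coord_proj (k : 'I_d) : 'cV[R]_d := delta_mx k 0 - u k 0 *: u.

Let dot_delta k (x : 'cV[R]_d) : dot (delta_mx k 0) x = x k 0.
Proof.
rewrite /dot (bigD1 k)//= mxE !eqxx mul1r big1 ?addr0// => i /negbTE ik.
by rewrite mxE ik mul0r.
Qed.

Let dot_proj k x : dot (coord_proj k) x = x k 0 - u k 0 * dot u x.
Proof. by rewrite dotBl dotZl dot_delta. Qed.

Let proj_perp k : dot u (coord_proj k) = 0.
Proof. by rewrite dotC dot_proj u1 mulr1 subrr. Qed.

Let proj_var k : dot (coord_proj k) (Sigma *m coord_proj k) <= s2.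
Proof.
apply: le_trans (Sigma_le (proj_perp k)) _; rewrite -[leRHS]mulr1 ler_pM2l//.
rewrite dot_proj proj_perp mulr0 subr0 !mxE !eqxx /= lerBlDr lerDl.
by rewrite -expr2 sqr_ge0.
Qed.

Let noise_entry (x : 'cV['cV[R]_d]_n) k j :
  noise_mx (data_matrix (fun j => x j 0)) u k j = dot (coord_proj k) (x j 0).
Proof.
rewrite dot_proj !mxE big_ord1 !mxE; congr (_ - _ * _).
by apply: eq_bigr => i _; rewrite !mxE mulrC.
Qed.

(** The two bad events are that the signal in the direction selected by the
    noise is small ([small_ball]), and that some entry of the noise exceeds
    [lam / n] ([gaussian_tail_abs], [union_bound]).  Outside them the signal
    squared is at least [l / (3 K)^2 - 1], the 1 being the loss due to the
    net, and the recovery is deterministic. *)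
Lemma cosine_probability (K : nat) (L r : R) : (0 < K)%N ->
  (forall k, u k 0 != 0 -> `|u k 0|^-1 <= L) -> 0 <= L -> 0 <= r < 1 ->
  (2 * lam * L) ^+ 2 + r ^+ 2 <= r ^+ 2 * (l / (9 * K%:R ^+ 2)) ->
  1 < l / (9 * K%:R ^+ 2) ->
  (P [set w | (`|dot (loading w) u| < (1 - r) / (1 + r))%R] <=
   (expR 2 / K%:R + d%:R * (n%:R *
     (2 * expR (- ((lam / n%:R) ^+ 2 / (2 * s2))))))%:E)%E.
Proof.
move=> K0 uL L0 r01 lamL lK.
pose tau := lam / n%:R.
have nR : 0 < n%:R :> R by rewrite ltr0n.
have KR : 0 < K%:R :> R by rewrite ltr0n.
have tau0 : 0 <= tau by rewrite divr_ge0.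
pose D := d%:R * (2 * n%:R ^+ 2 * tau ^+ 2).
have D0 : 0 <= D by rewrite mulr_ge0// mulr_ge0 ?sqr_ge0// mulr_ge0 ?sqr_ge0.
(* The mesh for which the loss [D * delta] in [signal_ge_net] is below 1. *)
pose delta := (D + 1)^-1.
have delta0 : 0 < delta by rewrite invr_gt0; lra.
have [N [W [N0 W1 net]]] := sphere_net n0 delta0.
pose F c (x : 'cV['cV[R]_d]_n) :=
  let A := noise_mx (data_matrix (fun j => x j 0)) u in dot (A *m W c) (A *m W c).
have mF c : measurable_fun [set: 'cV['cV[R]_d]_n] (F c).
  have mA k : measurable_fun [set: 'cV['cV[R]_d]_n] (fun x =>
      (noise_mx (data_matrix (fun j => x j 0)) u *m W c) k 0).
    under eq_fun do rewrite mxE.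
    apply: measurable_sum => j; apply: measurable_funM => //.
    under eq_fun do rewrite noise_entry.
    apply: measurableT_comp; first exact: measurable_dot.
    exact: measurable_fun_mx_entry.
  by apply: measurable_sum => k; apply: measurable_funM.
have Fs c x s : F c (shift_along u x s) = F c x.
  rewrite /F (_ : noise_mx _ u = noise_mx (data_matrix (fun j => x j 0)) u)//.
  apply/matrixP => k j.
  by rewrite !noise_entry mxE dotDr dotZr (dotC _ u) proj_perp mulr0 addr0.
have [B2 [mB2 PB2 B2P]] := small_ball normalX indX eigu u1 l0 W1 mF Fs N0 K0.
pose B1 := [set w | exists k : 'I_d, exists j : 'I_n,
  tau <= `|dot (coord_proj k) (X j w)|].
have mB1' k j : measurable [set w | tau <= `|dot (coord_proj k) (X j w)|].
  rewrite -[X in measurable X]setTI; apply: measurable_fun_le => //.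
  by apply: measurableT_comp => //; exact: measurable_dot_RV.
have mB1 : measurable B1.
  apply: (@measurable_exists_ord _ _ _ (fun k => [set w | exists j : 'I_n,
    tau <= `|dot (coord_proj k) (X j w)|])) => k.
  exact: (@measurable_exists_ord _ _ _ (fun j =>
    [set w | tau <= `|dot (coord_proj k) (X j w)|])).
have PB1 : (P B1 <= (d%:R * (n%:R * (2 * expR (- (tau ^+ 2 / (2 * s2))))))%:E)%E.
  apply: (@union_bound _ _ _ P _ (fun k => [set w | exists j : 'I_n,
    tau <= `|dot (coord_proj k) (X j w)|])) => k.
    exact: (@measurable_exists_ord _ _ _ (fun j =>
      [set w | tau <= `|dot (coord_proj k) (X j w)|])).
  apply: (@union_bound _ _ _ P _ (fun j =>
    [set w | tau <= `|dot (coord_proj k) (X j w)|])) => // j.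
  exact: (gaussian_tail_abs (normalX j)).
apply: (@le_trans _ _ (P (B2 `|` B1))); last first.
  apply: le_trans (measureU2 _ mB2 mB1) _; rewrite EFinD; exact: leeD.
apply: le_measure; rewrite ?inE.
- exact: measurable_loading_lt.
- exact: measurableU.
move=> w /= wlt; apply: contrapT => /not_orP[nB2 nB1].
have [c [cN cmax csc]] := B2P w nB2.
pose a := (M w)^T *m u.
have ME : data_matrix (fun j => (\col_j X j w) j 0) = M w :> 'M[R]_(d, n).
  by apply/matrixP => k j; rewrite !mxE.
have noise_le k j : `|noise_mx (M w) u k j| <= tau.
  rewrite -ME noise_entry mxE leNgt; apply/negP => /ltW hlt.
  by apply: nB1; exists k, j.
have [/enorm1P vv _] := v1_top w.
have rayleigh x : dot x x = 1 ->
    dot (M w *m x) (M w *m x) <= dot (M w *m v1 w) (M w *m v1 w).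
  move=> x1.
  have := @top_eigenvector_max _ _ _ _ x _ (v1_top w) x1.
  rewrite trmx_mul trmxK => /(_ erefl).
  by rewrite -!mulmxA !(dot_mulmx (M w)^T) trmxK.
have sig := @signal_ge_net _ d n (M w) u tau u1 noise_le (v1 w) N W delta c
  vv rayleigh W1 (ltW delta0) net.
have {sig} : dot a (W c) ^+ 2 - d%:R * (2 * n%:R ^+ 2 * tau ^+ 2 * delta) <=
    dot a (v1 w) ^+ 2.
  by apply: sig => c' c'N; have := cmax c' c'N; rewrite /F /= ME.
have -> : d%:R * (2 * n%:R ^+ 2 * tau ^+ 2 * delta) = D * delta by rewrite mulrA.
have Dd : D * delta <= 1 by rewrite ler_pdivrMr ?mul1r; lra.
have scoreE : score u (W c) (\col_j X j w) = dot a (W c).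
  apply: eq_bigr => j _; rewrite mulrC; congr (_ * _).
  by rewrite !mxE; apply: eq_bigr => i _; rewrite !mxE mulrC.
have aW : l / (9 * K%:R ^+ 2) < dot a (W c) ^+ 2.
  rewrite -scoreE -[ltRHS]real_normK ?num_real//.
  have -> : l / (9 * K%:R ^+ 2) = (Num.sqrt l / (3 * K%:R)) ^+ 2.
    by rewrite expr_div_n sqr_sqrtr ?(ltW l0)// exprMn; congr (_ / (_ * _)); ring.
  rewrite ltr_pXn2r// nnegrE//.

move=> sig; have av2 : l / (9 * K%:R ^+ 2) - 1 <= dot a (v1 w) ^+ 2 by lra.
have av0 : 0 < `|dot a (v1 w)|.
  by rewrite normr_gt0 -sqrf_eq0 gt_eqF//; lra.
have ntau : n%:R * tau <= lam by rewrite mulrC divfK// gt_eqF.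
have lamLa : 2 * lam * L <= r * `|dot a (v1 w)|.
  case/andP: r01 => r0 _.
  rewrite -(@ler_pXn2r _ 2)// ?nnegrE ?mulr_ge0//.
  rewrite [leRHS]exprMn real_normK ?num_real//.
  have := ler_wpM2l (sqr_ge0 r) av2; lra.
have := @sparse_loading_cosine _ d n (M w) u tau u1 noise_le (v1 w) h lam L r
  hh lam0 ntau vv uL av0 r01 lamLa.
by rewrite leNgt wlt.
Qed.

End cosine_probability.

(** * Asymptotics and the theorem *)

Section asymptotic_facts.
Variable R : realType.

Lemma limn_esup_lt_near (u : nat -> \bar R) (c : \bar R) :
  (limn_esup u < c)%E -> \forall d \near \oo, (u d < c)%E.
Proof.
move=> /ereal_inf_lt[_ [A nA <-] uc].
apply: filterS nA => d Ad; apply: le_lt_trans uc.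
by apply: ereal_sup_ubound; exists d.
Qed.

Lemma same_order_near (a b : nat -> R) : same_order a b ->
  (\forall d \near \oo, 0 < b d) ->
  exists c1 c2 : R, [/\ 0 < c1, 0 < c2 &
    \forall d \near \oo, c1 * b d <= a d <= c2 * b d].
Proof.
move=> [c1 [c2 [c10 c12 lb ub]]] b0.
exists (c1 / 2), (c2 + 1); split.
- by rewrite divr_gt0.
- by lra.
have h2 : \forall d \near \oo, ((a d / b d)%:E < (c2 + 1)%:E)%E.
  by apply: limn_esup_lt_near; apply: le_lt_trans ub _; rewrite lte_fin; lra.
have h1 : \forall d \near \oo, ((- (a d / b d))%:E < (- (c1 / 2))%:E)%E.
  apply: limn_esup_lt_near.
  move: lb; rewrite /limn_einf leeNr -EFinN => /le_lt_trans; apply.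
  by rewrite lte_fin; lra.
near=> d.
have bd : 0 < b d by near: d.
have : ((a d / b d)%:E < (c2 + 1)%:E)%E by near: d.
have : ((- (a d / b d))%:E < (- (c1 / 2))%:E)%E by near: d.
rewrite !lte_fin ltrN2 => /ltW; rewrite ler_pdivlMr// => -> /ltW.
by rewrite ler_pdivrMr.
Unshelve. all: by end_near. Qed.

Lemma dpow_gt0_near (s : R) : \forall d \near \oo, 0 < dpow s d.
Proof.
near=> d; rewrite powR_gt0// ltr0n; near: d; exact: nbhs_infty_gt.
Unshelve. all: by end_near. Qed.

Lemma dpowD (s t : R) d : (0 < d)%N -> dpow s d * dpow t d = dpow (s + t) d.
Proof.
by move=> d0; rewrite /dpow powRD// pnatr_eq0 -lt0n d0 implybT.
Qed.

Lemma powR_ge_near (s A : R) : 0 < s ->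
  exists x0 : R, forall x, x0 <= x -> A <= x `^ s.
Proof.
move=> s0; pose B := Num.max A 0.
have B0 : 0 <= B by rewrite le_max lexx orbT.
exists (B `^ s^-1) => x xB.
apply: (@le_trans _ _ B); first by rewrite le_max lexx.
have -> : B = (B `^ s^-1) `^ s by rewrite -powRrM mulVf ?gt_eqF// powRr1.
apply: ge0_ler_powR => //; rewrite ?nnegrE ?powR_ge0//; first exact: ltW.
by rewrite (le_trans _ xB)// powR_ge0.
Qed.

Lemma dpow_ge_near (s A : R) : 0 < s -> \forall d \near \oo, A <= dpow s d.
Proof.
move=> s0; have [x0 hx0] := powR_ge_near A s0.
near=> d; apply: hx0; near: d; exact: nbhs_infty_ger.
Unshelve. all: by end_near. Qed.

Lemma ln_ge_near (A : R) : \forall d \near \oo, A <= ln (d%:R : R).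
Proof.
near=> d.
have : expR A <= d%:R by near: d; exact: nbhs_infty_ger.
move=> h; rewrite -[A]expRK ler_ln ?posrE ?expR_gt0//.
exact: lt_le_trans (expR_gt0 _) h.
Unshelve. all: by end_near. Qed.

(** The slack [delta > 1 / 2] makes the Gaussian tail at [lambda] decay faster
    than any power of [d]. *)
Lemma ln_powR_ge_near (delta A : R) : 1 / 2 < delta ->
  \forall d \near \oo, A * ln (d%:R : R) <= (ln d%:R `^ delta) ^+ 2.
Proof.
move=> d2; have k0 : 0 < 2 * delta - 1 by lra.
have [x0 hx0] := powR_ge_near A k0.
near=> d.
have l1 : 1 <= ln (d%:R : R) by near: d; exact: ln_ge_near.
have lx : x0 <= ln (d%:R : R) by near: d; exact: ln_ge_near.
have l0 : 0 < ln (d%:R : R) by lra.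
have -> : (ln (d%:R : R) `^ delta) ^+ 2 = ln d%:R `^ (2 * delta - 1) * ln d%:R.
  rewrite expr2 -powRD; last by apply/implyP => _; rewrite (gt_eqF l0).
  rewrite -[X in _ = _ * X]powRr1 ?ltW// -powRD; last by apply/implyP => _; rewrite (gt_eqF l0).
  by congr (_ `^ _); ring.
by rewrite ler_wpM2r ?hx0// ltW.
Unshelve. all: by end_near. Qed.

(** Turns an event on the angle into one on the cosine, whose measurability is
    [measurable_loading_lt]. *)
Lemma acos_gt_cos (e c : R) : 0 < e -> 0 <= c <= 1 ->
  (e < acos c) = (e < pi) && (c < cos e).
Proof.
move=> e0 /andP[c0 c1].
have c' : -1 <= c <= 1 by rewrite c1 andbT (le_trans _ c0)// lerN10.
have [epi|epi] := ltP e pi; last first.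
  by apply/negbTE; rewrite -leNgt (le_trans (acos_lepi c')).
have eI : e \in `[0, pi] by rewrite in_itv/= (ltW e0) (ltW epi).
have aI : acos c \in `[0, pi] by rewrite in_itv/= acos_ge0// acos_lepi.
have -> : (c < cos e) = (cos (acos c) < cos e) by rewrite acosK ?in_itv.
by rewrite ltr_cos.
Qed.

End asymptotic_facts.

Theorem theorem3p1 (R : realType) (n : nat) (hn : (1 <= n)%N)
  (alpha beta theta eta delta gamma C : R)
  (hbeta : 0 <= beta <= 1)
  (disp : nat -> measure_display) (T : forall d, measurableType (disp d))
  (P : forall d, probability (T d) R)
  (X : forall d, 'I_n -> {RV P d >-> 'cV[R]_d})
  (Sigma : forall d, 'M[R]_d)
  (hXnormal : forall d j, normal_vector (P d) (X d j) (Sigma d))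
  (hXindep : forall d, mutually_independent (P d) (fun j => X d j))
  (* eigenvalues and eigenvectors of Sigma d, indexed from 1 to d *)
  (lam : nat -> nat -> R) (u : forall d, nat -> 'cV[R]_d)
  (hlam : forall d i j, (1 <= i)%N -> (i <= j)%N -> (j <= d)%N ->
    lam d j <= lam d i)
  (heig : forall d i, (1 <= i <= d)%N -> Sigma d *m u d i = lam d i *: u d i)
  (horth : forall d i j, (1 <= i <= d)%N -> (1 <= j <= d)%N ->
    dot (u d i) (u d j) = (i == j)%:R)
  (* coordinates k : 'I_d are indexed from 0 *)
  (hu1 : forall d (k : 'I_d),
    (u d 1%N k 0 != 0) = (k.+1 <= Num.truncn (dpow beta d))%N)
  (halpha : 0 < alpha <= 1) (htheta : 0 <= theta < alpha)
  (hlam1 : same_order (fun d => lam d 1%N) (dpow alpha))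
  (hlam2 : same_order (fun d => lam d 2%N) (dpow theta))
  (hlamsum : same_order (fun d => \sum_(2 <= i < d.+1) lam d i)
                        (fun d => d%:R))
  (hC : 0 <= C)
  (hlimsup : limn_esup
     (fun d => (lam d 1%N / \sum_(2 <= i < d.+1) lam d i)%:E) = C%:E)
  (hratio : (fun d => (\sum_(1 <= i < d.+1) lam d i ^+ 2) /
                      (\sum_(1 <= i < d.+1) lam d i) ^+ 2) @ \oo --> (0 : R))
  (heta : 0 <= eta < alpha)
  (hmax : same_order
     (fun d => \big[Num.max/0]_(k < d | (k.+1 <= Num.truncn (dpow beta d))%N)
                 `|u d 1%N k 0|^-1)
     (dpow (eta / 2)))
  (Delta : forall d, 'M[R]_d) (rho : nat -> R)
  (hHnormal : forall d j,
    normal_vector (P d) (fun w => tail_projection (u d) (X d j w)) (Delta d))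
  (hmix : forall d (k l : 'I_d),
    (k.+1 <= Num.truncn (dpow beta d))%N ->
    (l.+1 <= Num.truncn (dpow beta d))%N -> k != l ->
    `|Delta d k l| <=
      Num.sqrt (Delta d k k) * Num.sqrt (Delta d l l) * rho `|k - l|%N)
  (hrho1 : forall t, (1 < t)%N -> rho t < 1)
  (hrho0 : (fun t : nat => rho t * ln t%:R) @ \oo --> (0 : R))
  (lambda : nat -> R)
  (hdelta : 1 / 2 < delta) (hgamma : theta < gamma < alpha - eta)
  (hlambda : \forall d \near \oo,
    ln d%:R `^ delta * dpow (theta / 2) d <= lambda d <= dpow (gamma / 2) d)
  (h : R -> R -> R) (hh : thresholding_function h)
  (v1 : forall d, {RV P d >-> 'cV[R]_n})
  (hv1 : forall d w, let M := data_matrix (fun j => X d j w) in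
    top_unit_eigenvector (M^T *m M) (v1 d w)) :
  cvg_in_probability P
    (fun d w => angle
       (sparse_loading h (lambda d) (data_matrix (fun j => X d j w)) (v1 d w))
       (u d 1%N))
    0.
Proof.
move=> e e0.
have /andP[alpha0 _] := halpha; have /andP[theta0 _] := htheta.
have /andP[eta0 _] := heta; have /andP[gt ga] := hgamma.
have [c1 [C1 [c10 C10 hl1]]] := same_order_near hlam1 (dpow_gt0_near alpha).
have [c2 [C2 [c20 C20 hl2]]] := same_order_near hlam2 (dpow_gt0_near theta).
have [c3 [C3 [c30 C30 hL]]] := same_order_near hmax (dpow_gt0_near (eta / 2)).
set E := fun d => _.
suff key : forall z : R, 0 < z -> \forall d \near \oo, (E d <= z%:E)%E.
  have E0 d : (0 <= E d)%E by exact: measure_ge0.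
  apply/fine_cvgP; split.
    near=> d; rewrite ge0_fin_numE//; apply: (@le_lt_trans _ _ (1 : R)%:E); last exact: ltry.
    by near: d; exact: key.
  apply/cvgrPdist_le => z z0; near=> d.
  have Ez : (E d <= z%:E)%E by near: d; exact: key.
  rewrite sub0r normrN /= ger0_norm ?fine_ge0// -lee_fin fineK//.
  by rewrite ge0_fin_numE// (le_lt_trans Ez)// ltry.
move=> z z0.
have EE d : (0 < d)%N -> E d = P d [set w | (e < pi) &&
    (`|dot (sparse_loading h (lambda d) (data_matrix (fun j => X d j w)) (v1 d w))
         (u d 1%N)| < cos e)].
  move=> d0; rewrite /E; congr (P d _); apply/seteqP.
  have uu : dot (u d 1%N) (u d 1%N) = 1 by rewrite horth ?d0.
  split=> w /=; rewrite subr0 /angle => H.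
    rewrite -acos_gt_cos ?normr_ge0 ?dot_normalize_le1//.
    by rewrite ger0_norm ?acos_ge0 ?dot_normalize_le1// ?(le_trans _ (normr_ge0 _)) ?lerN10 in H.
  rewrite ger0_norm; last first.
    by rewrite acos_ge0// dot_normalize_le1// (le_trans _ (normr_ge0 _))// lerN10.
  by rewrite acos_gt_cos// normr_ge0 dot_normalize_le1.
have [epi|epi] := leP pi e.
  near=> d; rewrite EE; last by near: d; exact: nbhs_infty_gt.
  rewrite [X in P d X](_ : _ = set0) ?measure0 ?lee_fin ?ltW//.
  by apply/seteqP; split=> w //=; rewrite ltNge epi.
have ce1 : cos e < 1.
  by rewrite -cos0 ltr_cos// in_itv/= ?lexx ?pi_ge0// (ltW e0) (ltW epi).
have ceN1 := cos_geN1 e.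
(* A relative error [r] that keeps the cosine at least [cos e]. *)
pose r := (1 - cos e) / 4.
have r0 : 0 < r by rewrite divr_gt0//; lra.
have r2 : 0 < r ^+ 2 by rewrite exprn_gt0.
have rc : cos e <= (1 - r) / (1 + r).
  rewrite ler_pdivlMr; last by lra.
  have -> : cos e = 1 - 4 * r by rewrite /r; field.
  by nra.
(* The small ball event then has probability at most [z / 2]. *)
pose K := (Num.truncn (2 * expR 2 / z)).+1.
have KR : 0 < K%:R :> R by rewrite ltr0n.
have K2 : 0 < 9 * K%:R ^+ 2 :> R by rewrite mulr_gt0// exprn_gt0.
have Kz : expR 2 / K%:R <= z / 2.
  rewrite ler_pdivrMr// -ler_pdivrMl ?divr_gt0//.
  rewrite (_ : (z / 2)^-1 * expR 2 = 2 * expR 2 / z); last by field; rewrite gt_eqF.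
  by rewrite ltW// /K truncnS_gt.
(* [A1] and [A2] are the thresholds beyond which the powers of [d] satisfy the
   two requirements of [cosine_probability] on the signal. *)
pose A1 := (4 * C3 ^+ 2 + r ^+ 2) * (9 * K%:R ^+ 2) / (r ^+ 2 * c1).
pose A2 := 9 * K%:R ^+ 2 / c1 + 1.
have nR : 0 < n%:R :> R by rewrite ltr0n.
near=> d.
have d1 : (1 < d)%N by near: d; exact: nbhs_infty_gt.
have d0 : (0 < d)%N by exact: ltnW.
have dR : 0 < d%:R :> R by rewrite ltr0n.
have dd0 s : 0 < dpow s d :> R by rewrite powR_gt0.
have /andP[l1 _] : c1 * dpow alpha d <= lam d 1%N <= C1 * dpow alpha d by near: d.
have /andP[_ l2] : c2 * dpow theta d <= lam d 2%N <= C2 * dpow theta d by near: d.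
have /andP[_ uL] : c3 * dpow (eta / 2) d <=
    \big[Num.max/0]_(k < d | (k.+1 <= Num.truncn (dpow beta d))%N)
                 `|u d 1%N k 0|^-1 <= C3 * dpow (eta / 2) d by near: d.
have /andP[lb ub] : ln d%:R `^ delta * dpow (theta / 2) d <= lambda d
    <= dpow (gamma / 2) d by near: d.
have hA1 : A1 <= dpow (alpha - (gamma + eta)) d.
  by near: d; apply: dpow_ge_near; lra.
have hA2 : A2 <= dpow alpha d by near: d; exact: dpow_ge_near.
have hG : 1 <= dpow (gamma + eta) d :> R by near: d; apply: dpow_ge_near; lra.
have hA3 : 4 * n%:R ^+ 2 * C2 * ln d%:R <= (ln d%:R `^ delta) ^+ 2.
  by near: d; exact: ln_powR_ge_near.
have hA4 : 4 * n%:R / z <= d%:R by near: d; exact: nbhs_infty_ger.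
have lam0 : 0 <= lambda d by apply: le_trans lb; rewrite mulr_ge0 ?powR_ge0.
have l10 : 0 < lam d 1%N by apply: lt_le_trans l1; rewrite mulr_gt0.
have eig1 : Sigma d *m u d 1%N = lam d 1%N *: u d 1%N by rewrite heig// d0.
have uu : dot (u d 1%N) (u d 1%N) = 1 by rewrite horth ?d0.
pose s2 := C2 * dpow theta d.
have s20 : 0 < s2 by rewrite mulr_gt0.
have Sle p : dot (u d 1%N) p = 0 -> dot p (Sigma d *m p) <= s2 * dot p p.
  apply: (@eigenbasis_quadratic_le _ _ _ (lam d) (u d)).
  - by move=> i; exact: heig.
  - by move=> i j; exact: horth.
  - by move=> i /andP[i2 id]; apply: le_trans l2; apply: hlam.
pose L := C3 * dpow (eta / 2) d.
have L0 : 0 <= L by rewrite mulr_ge0// ltW.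
have uL' k : u d 1%N k 0 != 0 -> `|u d 1%N k 0|^-1 <= L.
  rewrite hu1 => hk; apply: le_trans uL.
  by apply: (le_bigmax_cond 0 (fun k : 'I_d => `|u d 1%N k 0|^-1)).
have lK : dpow alpha d * c1 / (9 * K%:R ^+ 2) <= lam d 1%N / (9 * K%:R ^+ 2).
  by rewrite ler_wpM2r ?invr_ge0 ?(ltW K2)// mulrC.
have signal : (2 * lambda d * L) ^+ 2 + r ^+ 2 <=
    r ^+ 2 * (lam d 1%N / (9 * K%:R ^+ 2)).
  apply: (@le_trans _ _ ((4 * C3 ^+ 2 + r ^+ 2) * dpow (gamma + eta) d)).
    rewrite [leRHS]mulrDl lerD//; last by rewrite ler_peMr// ltW.
    have -> : 4 * C3 ^+ 2 * dpow (gamma + eta) d =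
        (2 * dpow (gamma / 2) d * L) ^+ 2.
      have -> : gamma + eta = (gamma / 2 + eta / 2) + (gamma / 2 + eta / 2).
        by field.
      by rewrite /L -!dpowD//; ring.
    rewrite ler_pXn2r// ?nnegrE ?mulr_ge0// ?(ltW (dd0 _)) ?(ltW C30)//.
    by rewrite ler_wpM2r// ler_wpM2l.
  apply: le_trans (ler_wpM2l (ltW r2) lK).
  have -> : dpow alpha d = dpow (alpha - (gamma + eta)) d * dpow (gamma + eta) d.
    by rewrite dpowD// subrK.
  have -> : r ^+ 2 * (dpow (alpha - (gamma + eta)) d * dpow (gamma + eta) d * c1 /
      (9 * K%:R ^+ 2)) = dpow (alpha - (gamma + eta)) d * (r ^+ 2 * c1 /
      (9 * K%:R ^+ 2)) * dpow (gamma + eta) d by ring.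
  rewrite ler_wpM2r// ?(ltW (dd0 _))//.
  have q0 : 0 < r ^+ 2 * c1 / (9 * K%:R ^+ 2) by rewrite divr_gt0// mulr_gt0.
  apply: le_trans (ler_wpM2r (ltW q0) hA1).
  rewrite /A1 le_eqVlt; apply/orP; left; apply/eqP.
  by field; rewrite !gt_eqF.
have signal1 : 1 < lam d 1%N / (9 * K%:R ^+ 2).
  apply: lt_le_trans lK; rewrite ltr_pdivlMr// mul1r.
  have := ler_wpM2r (ltW c10) hA2.
  rewrite /A2 [leLHS]mulrDl divfK ?gt_eqF// mul1r; lra.
(* By [hA3] the exponent is at least [2 ln d]. *)
have tail : expR (- ((lambda d / n%:R) ^+ 2 / (2 * s2))) <= (d%:R ^+ 2)^-1.
  rewrite -[leRHS]lnK ?posrE ?invr_gt0 ?exprn_gt0// ler_expR lnV ?posrE ?exprn_gt0//.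
  rewrite lerN2 lnXn// ler_pdivlMr ?mulr_gt0//.
  rewrite expr_div_n ler_pdivlMr ?exprn_gt0//.
  apply: (@le_trans _ _ ((ln d%:R `^ delta * dpow (theta / 2) d) ^+ 2)); last first.
    by rewrite ler_pXn2r// ?nnegrE ?mulr_ge0 ?powR_ge0.
  have -> : (ln d%:R `^ delta * dpow (theta / 2) d) ^+ 2 =
      (ln d%:R `^ delta) ^+ 2 * dpow theta d.
    by rewrite exprMn [X in _ * X]expr2 dpowD// -splitr.
  have := ler_wpM2r (ltW (dd0 theta)) hA3.
  rewrite /s2; apply: le_trans; rewrite le_eqVlt; apply/orP; left; apply/eqP.
  by rewrite -mulr_natl; ring.
rewrite EE// epi /=.
have r01 : 0 <= r < 1 by rewrite (ltW r0) /= /r; lra.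
have main := @cosine_probability _ _ _ (P d) d n (X d) (v1 d) h (lambda d)
  (u d 1%N) hh lam0 (Sigma d) (lam d 1%N) s2 (hXnormal d) (@hXindep d) eig1 uu l10
  s20 Sle (hv1 d) hn K L r isT uL' L0 r01 signal signal1.
apply: (@le_trans _ _ (P d [set w | `|dot (sparse_loading h (lambda d)
    (data_matrix (fun j => X d j w)) (v1 d w)) (u d 1%N)| < (1 - r) / (1 + r)])).
  apply: le_measure; rewrite ?inE.
  - exact: measurable_loading_lt.
  - exact: measurable_loading_lt.
  - by move=> w /= /lt_le_trans; apply.
apply: le_trans main _; rewrite lee_fin (splitr z) lerD//.
apply: (@le_trans _ _ (d%:R * (n%:R * (2 * (d%:R ^+ 2)^-1)))).
  by rewrite !ler_pM2l.
have -> : d%:R * (n%:R * (2 * (d%:R ^+ 2)^-1)) = 2 * n%:R / d%:R :> R.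
  by field; rewrite gt_eqF.
rewrite ler_pdivrMr//; move: hA4; rewrite ler_pdivrMr//; lra.
Unshelve. all: by end_near. Qed.
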